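(* Assume that the exponential curvature condition $CDE'(\kappa_e,\infty)$ holds with $\kappa_e>0$. Then for every probability measure $\nu=f\pi$ on $\mathcal{X}$ (with density $f$ with respect to $\pi$), $$\widetilde{W}_2(f\pi|\pi)^2\leq \frac{2J}{\kappa_e^2}\,\mathcal{I}_\pi(f) \leq \frac{2}{\kappa_e^2}\,\mathcal{I}_\pi(f).$$
   Context: Setting: $\mathcal{X}$ is a finite or countably infinite set and $K$ is an irreducible Markov kernel on $\mathcal{X}$, with $\sum_y K(x,y)=1$ for all $x\in\mathcal{X}$. $\pi$ is a reversible invariant probability measure: $K(x,y)\pi(x)=K(y,x)\pi(y)$ for all $x,y$. $J(x)=1-K(x,x)$ and $J=\sup_{x}J(x)$, so $0<J\le1$. The generator is $Lf(x)=\sum_y (f(y)-f(x))K(x,y)$. The carré du champ is $\Gamma(f,g)(x)=\frac12\sum_y (f(y)-f(x))(g(y)-g(x))K(x,y)$, with $\Gamma(f)=\Gamma(f,f)$. Curvature: $\Gamma_2(f)=\frac12 L\Gamma(f)-\Gamma(f,Lf)$ and $\widetilde\Gamma_2(f)=\Gamma_2(f)-\Gamma\left(f,\frac{\Gamma(f)}{f}\right)$. The condition $CDE'(\kappa_e,\infty)$ means that for all nonnegative functions $f$ and all $x\in\mathcal{X}$, $\widetilde\Gamma_2(f)(x)\ge\kappa_e\Gamma(f)(x)$. Distance: $d$ is the graph distance, $d(x,y)=$ smallest $n\in\mathbb{N}$ such that there exist $x_0=x,\dots,x_n=y$ with $K(x_i,x_{i+1})>0$ for $0\le i\le n-1$.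 Weak transport cost: for probability measures $\mu,\nu$ on $\mathcal{X}$, $$\widetilde W_2(\nu|\mu)^2=\inf_{q\in\Pi(\mu,\nu)}\int\left(\int d(x,y)\,p_x(dy)\right)^2\mu(dx),$$ where $\Pi(\mu,\nu)$ is the set of couplings $q$ with first marginal $\mu$ and second marginal $\nu$, and $p_x$ is the probability kernel with $q(dx\,dy)=p_x(dy)\mu(dx)$. Fisher information: for $f\ge 0$, $\mathcal{I}_\pi(f)=4\int\Gamma(\sqrt f)\,d\pi$. *)

(* Defs.v *)
From HB Require Import structures.
From mathcomp Require Import all_boot all_order all_algebra.
From mathcomp Require Import boolp classical_sets reals ereal numfun esum.

Set Implicit Arguments.
Unset Strict Implicit.
Unset Printing Implicit Defensive.
Import Order.TTheory GRing.Theory Num.Theory.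
Local Open Scope classical_set_scope.
Local Open Scope ring_scope.
Local Open Scope ereal_scope.

Section discrete_markov.
Variables (R : realType) (X : countType).
Implicit Types (K : X -> X -> R) (mu nu pi w : X -> R) (a f g : X -> \bar R).

(* [\esum] is only meaningful for nonnegative families; a signed family is
   summed by parts.  When both parts are infinite the value is junk (-oo). *)
Definition ssum a : \bar R :=
  \esum_(y in [set: X]) a^\+ y - \esum_(y in [set: X]) a^\- y.

Definition is_prob w : Prop :=
  (forall x, (0 <= w x)%R) /\ \esum_(x in [set: X]) (w x)%:E = 1.

Definition markov_kernel K : Prop := forall x, is_prob (K x).

Fixpoint kernel_pow K (n : nat) (x y : X) : \bar R :=
  if n is m.+1 then \esum_(z in [set: X]) ((K x z)%:E * kernel_pow K m z y)
  else ((x == y)%:R)%:E.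

Definition irreducible K : Prop :=
  forall x y, exists n, 0 < kernel_pow K n x y.

Definition reversible K pi : Prop :=
  forall x y, (K x y * pi x = K y x * pi y)%R.

Definition jump_rate K (x : X) : R := (1 - K x x)%R.

Definition sup_jump_rate K : R := sup (range (jump_rate K)).

(* [gen] and [cdc] take extended-real functions because Gamma(f) / f is +oo
   where f vanishes and Gamma(f) does not. *)
Definition gen K f (x : X) : \bar R :=
  ssum (fun y => (f y - f x) * (K x y)%:E).

Definition cdc K f g (x : X) : \bar R :=
  (2^-1)%:E * ssum (fun y => (f y - f x) * (g y - g x) * (K x y)%:E).

Definition Gamma K f : X -> \bar R := cdc K f f.

Definition Gamma2 K f (x : X) : \bar R :=
  (2^-1)%:E * gen K (Gamma K f) x - cdc K f (gen K f) x.

(* The conventions are those of \bar R: c / 0 = +oo for c > 0, 0 / 0 = 0 and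
   0 * +oo = 0.  The value given to 0 / 0 is irrelevant when K x y > 0
   implies K y x > 0: it is only ever multiplied by f y - f x = 0. *)
Definition tGamma2 K f (x : X) : \bar R :=
  Gamma2 K f x - cdc K f (fun y => Gamma K f y / f y) x.

(* On an infinite space Gamma2 f x is an infinite sum that need not converge for
   unbounded f.  Under the two conditions below, Gamma2 f x is a finite number
   all of whose constituent sums converge absolutely, and, for f >= 0 and K x y > 0
   equivalent to K y x > 0, the last term of tGamma2 f x is an unambiguous sum in
   [-oo, +oo[.  They hold for every bounded f (hence for every f when X is
   finite), and whenever x and its neighbors have finitely many neighbors. *)
Definition Gamma2_defined K f (x : X) : Prop :=
  Gamma K f x < +oo /\ \esum_(y in [set: X]) (Gamma K f y * (K x y)%:E) < +oo.

Definition CDE' K (kappa : R) : Prop :=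
  forall f : X -> R, (forall y, (0 <= f y)%R) ->
  forall x, Gamma2_defined K (EFin \o f) x ->
    kappa%:E * Gamma K (EFin \o f) x <= tGamma2 K (EFin \o f) x.

Definition graph_dist K (x y : X) : \bar R :=
  ereal_inf [set ((size s)%:R)%:E | s in
    [set s : seq X | path (fun u v => (0 < K u v)%R) x s /\ last x s = y]].

Definition coupling mu nu (q : X -> X -> R) : Prop :=
  [/\ forall x y, (0 <= q x y)%R,
      forall x, \esum_(y in [set: X]) (q x y)%:E = (mu x)%:E &
      forall y, \esum_(x in [set: X]) (q x y)%:E = (nu y)%:E].

(* p is unconstrained where mu vanishes, but does not contribute there. *)
Definition disintegration mu (q p : X -> X -> R) : Prop :=
  markov_kernel p /\ forall x y, (q x y = p x y * mu x)%R.

Definition weak_cost K mu (p : X -> X -> R) : \bar R :=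
  \esum_(x in [set: X])
    ((\esum_(y in [set: X]) (graph_dist K x y * (p x y)%:E)) ^+ 2 * (mu x)%:E).

(* \widetilde W_2(nu | mu)^2 *)
Definition weak_W2_sq K nu mu : \bar R :=
  ereal_inf [set c | exists q p, [/\ coupling mu nu q, disintegration mu q p &
                                     c = weak_cost K mu p]].

Definition fisher_info K pi (f : X -> R) : \bar R :=
  4%:E * \esum_(x in [set: X])
    (Gamma K (fun y => (Num.sqrt (f y))%:E) x * (pi x)%:E).

End discrete_markov.

(* Main.v *)
Require Import Defs.
From mathcomp Require Import all_boot all_order all_algebra.
From mathcomp Require Import boolp classical_sets cardinality fsbigop.
From mathcomp Require Import reals ereal numfun esum.
From mathcomp Require Import ring lra.
Set Implicit Arguments.
Unset Strict Implicit.
Unset Printing Implicit Defensive.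
Import Order.TTheory GRing.Theory Num.Theory.
Local Open Scope ring_scope.

(** Let [f_(n+1)] be the implicit Euler iterates [f_n = f_(n+1) - h L f_(n+1)] of
    the heat flow, started from [f_0 = f] (truncated so that it takes values in
    a compact subinterval of the positive reals).  Since [g |-> int Gamma(sqrt g)]
    is convex, CDE' makes the energy [E_n = int Gamma(sqrt f_n)] decay by a factor
    [1 + 2 kappa h] per step; hence [f_n -> 1], and a coupling of [pi] with
    [f pi] is obtained by following the iterates backwards, from [f_n pi] to
    [f_(n-1) pi].  In one step the mass at [y] jumps to [z] at rate
    [K(y,z) (G(z) - G(y))_+ / G(y)] with [G = f_n]; with [g = sqrt G] this is
    [K (g(z) - g(y))_+^2 / G(y) + 2 K (g(z) - g(y))_+ / g(y)].  The first part has
    total mass [E_n], the second one has square norm at most [4 J E_n] in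
    [L^2(G pi)].

    Let [m(x)] be the mean distance already travelled from [x], and [z_n] its
    square norm.  The second part contributes [2 sqrt(z_n) sqrt(4 J E_n)] to the
    growth of [z_n].  The first one is only small in [L^1], and contributes
    [2 D E_n] where [D] is the diameter of the graph.  CDE' implies CD (apply it
    to [1 + e u] and let [e -> 0]), whose gradient estimate gives
    [D <= 2 J / kappa]; the two contributions then have the same order, and
    [8 J E_n / kappa^2] turns out to be a supersolution of the recursion for [z_n]. *)

(** * Absolutely summable real families *)

(** Implicit steps stand in for the heat semigroup: each is a bounded linear equation solved by
    contraction, the maximum principle keeps its solution in the interval of the data, and CDE'
    enters through one exact convexity inequality instead of a derivative in time.

    The constant 8 is found in the limit of small steps. Backwards in time [E] grows at rate at
    least [2 kappa E], so [8 J E / kappa^2] grows at least by [16 J E / kappa]; with this value for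
    [z] the two contributions are [8 sqrt 2 J E / kappa] and [4 J E / kappa]. Since
    [8 sqrt 2 + 4 < 16], some room is left to absorb errors of order [h^2]. As the Fisher
    information is four times the energy, the bound reads [2 J / kappa^2] times it.

    After finitely many steps [f_n] is only close to 1, and the truncated density is only close to
    [f]. Both marginals are repaired by redrawing a small mass, which costs little because the
    diameter is finite. *)

Section esum_real.
Context {R : realType}.

Lemma esumZl (T : choiceType) (c : R) (a : T -> \bar R) :
  0 <= c -> (forall x, 0 <= a x)%E ->
  (\esum_(x in setT) (c%:E * a x) = c%:E * \esum_(x in setT) a x)%E.
Proof.
move=> c0 a0; rewrite /esum -ereal_supZl //; last first.
  by apply/set0P; exists (\sum_(x \in set0) a x)%E; exists set0 => //; exact: fsets_set0.
congr ereal_sup; apply/seteqP; split => z /=.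
  move=> [A fA <-]; exists (\sum_(x \in A) a x)%E; first by exists A.
  by rewrite ge0_mule_fsumr.
move=> [_ [A fA <-] <-]; exists A => //.
by rewrite ge0_mule_fsumr.
Qed.

Lemma esum_exchange (T T' : choiceType) (a : T -> T' -> \bar R) :
  (forall x y, 0 <= a x y)%E ->
  (\esum_(x in setT) \esum_(y in setT) a x y =
   \esum_(y in setT) \esum_(x in setT) a x y)%E.
Proof.
move=> a0; rewrite !esum_esum //.
rewrite (reindex_esum (setT `*`` (fun=> setT)) _ (fun x => (x.2, x.1))) //.
split => //=; first by move=> [i1 i2] [j1 j2] _ _ [-> ->].
by move=> [i1 i2] _; exists (i2, i1).
Qed.

Lemma esum_fin_ge (T : choiceType) (a : T -> \bar R) x :
  (forall x, 0 <= a x)%E -> (a x <= \esum_(x in setT) a x)%E.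
Proof.
move=> a0; rewrite (esumID [set x])// setTI esum_set1 // leeDl //.
exact: esum_ge0.
Qed.

Lemma esum_delta (T : choiceType) (a : T -> \bar R) x0 :
  (forall x, 0 <= a x)%E -> (forall x, x != x0 -> a x = 0%E) ->
  (\esum_(x in setT) a x = a x0)%E.
Proof.
move=> a0 az; rewrite (esumID [set x0])// setTI esum_set1 // esum1 ?adde0 //.
by move=> x [_ /= /eqP/az].
Qed.

End esum_real.

Section real_sums.
Context {R : realType} {T : countType}.
Implicit Types (a b : T -> R).

Definition summ a : Prop := summable setT (EFin \o a).

(** Outside [summ] the sum is infinite and [fine] sends it to 0. *)
Definition sm a : R := fine (ssum (EFin \o a)).

Let es a : R := fine (\esum_(x in setT) (a x)%:E)%E.

Lemma summ_le a b : summ b -> (forall x, `|a x| <= b x) -> summ a.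
Proof.
move=> + ab; apply: le_lt_trans; apply: le_esum => x _ /=.
by rewrite lee_fin (le_trans (ab x)) // ler_norm.
Qed.

Lemma ge0_summ a : (forall x, 0 <= a x) ->
  (\esum_(x in setT) (a x)%:E < +oo)%E -> summ a.
Proof.
move=> a0; apply: le_lt_trans; apply: le_esum => x _ /=.
by rewrite ger0_norm.
Qed.

Let esE a : (forall x, 0 <= a x) -> summ a ->
  (\esum_(x in setT) (a x)%:E)%E = (es a)%:E.
Proof.
move=> a0; rewrite /summ summableE => sa; rewrite /es fineK //.
have -> // : (\esum_(x in setT) (a x)%:E = \esum_(x in setT) `|(EFin \o a) x|)%E.
by apply: eq_esum => x _ /=; rewrite ger0_norm.
Qed.

Lemma summD a b : summ a -> summ b -> summ (fun x => a x + b x).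
Proof. by move=> sa sb; have := summableD sa sb. Qed.

Lemma summN a : summ a -> summ (fun x => - a x).
Proof. by rewrite /summ summableN. Qed.

Lemma summZ c a : summ a -> summ (fun x => c * a x).
Proof.
rewrite /summ /summable => sa.
have -> : (\esum_(x in setT) `|(EFin \o (fun x => c * a x)%R) x| =
  \esum_(x in setT) (`|c|%:E * `|(EFin \o a) x|))%E.
  by apply: eq_esum => x _ /=; rewrite normrM EFinM.
have := esum_ge0 (fun x (_ : setT x) => abse_ge0 ((EFin \o a) x)).
rewrite esumZl //; case: (\esum_(_ in _) _)%E sa => //= r _ _.
by rewrite -EFinM ltry.
Qed.

Let ssumB a b : (forall x, 0 <= a x) -> (forall x, 0 <= b x) ->
  summ a -> summ b ->
  ssum (EFin \o (fun x => a x - b x)) = (es a - es b)%:E.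
Proof.
move=> a0 b0 sa sb; rewrite EFinB -!esE //.
exact: (esumB sa sb (fun x _ => a0 x) (fun x _ => b0 x)).
Qed.

(** Halves of sums with the norm, in place of maxima, keep the decomposition linear for [lra] and
    [ring]. *)
Let posp a x := (`|a x| + a x) / 2.
Let negp a x := (`|a x| - a x) / 2.

Let posp0 a x : 0 <= posp a x.
Proof. by rewrite /posp; have := ler_norm (- a x); rewrite normrN => ?; lra. Qed.
Let negp0 a x : 0 <= negp a x.
Proof. by rewrite /negp; have := ler_norm (a x) => ?; lra. Qed.
Let posnegE a : a = (fun x => posp a x - negp a x).
Proof. by apply/funext => x; rewrite /posp /negp; lra. Qed.
Let summ_norm a : summ a -> summ (fun x => `|a x|).
Proof.
by move=> sa; apply: le_lt_trans sa; apply: le_esum => x _ /=; rewrite normr_id.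
Qed.
Let summ_posp a : summ a -> summ (posp a).
Proof.
move=> sa; apply: (summ_le (summ_norm sa)) => x; rewrite ger0_norm //.
by rewrite /posp; have := ler_norm (a x) => ?; lra.
Qed.
Let summ_negp a : summ a -> summ (negp a).
Proof.
move=> sa; apply: (summ_le (summ_norm sa)) => x; rewrite ger0_norm //.
by rewrite /negp; have := ler_norm (- a x); rewrite normrN => ?; lra.
Qed.

Lemma ssumE a : summ a -> ssum (EFin \o a) = (sm a)%:E.
Proof.
move=> sa; rewrite /sm; rewrite (posnegE a).
by rewrite ssumB //; [exact: summ_posp|exact: summ_negp].
Qed.

Let smB a b : (forall x, 0 <= a x) -> (forall x, 0 <= b x) ->
  summ a -> summ b -> sm (fun x => a x - b x) = es a - es b.
Proof. by move=> *; rewrite /sm ssumB. Qed.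

Let es0 : es (fun=> 0) = 0.
Proof. by rewrite /es esum1. Qed.

Let summ0 : summ (fun=> 0).
Proof. by rewrite /summ /summable esum1 //= => x _; rewrite normr0. Qed.

Lemma esum_smE a : (forall x, 0 <= a x) -> summ a ->
  (\esum_(x in setT) (a x)%:E)%E = (sm a)%:E.
Proof.
move=> a0 sa; rewrite esE //; congr EFin.
rewrite [in RHS](_ : a = (fun x => a x - 0)); last by apply/funext=> x; rewrite subr0.
by rewrite smB // es0 subr0.
Qed.

Let esD a b : (forall x, 0 <= a x) -> (forall x, 0 <= b x) ->
  summ a -> summ b -> es (fun x => a x + b x) = es a + es b.
Proof.
move=> a0 b0 sa sb; apply: EFin_inj; rewrite EFinD -!esE //; last 2 first.
- by move=> x; rewrite addr_ge0.
- exact: summD.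
by rewrite -esumD // => x _; rewrite lee_fin.
Qed.

Lemma smD a b : summ a -> summ b -> sm (fun x => a x + b x) = sm a + sm b.
Proof.
move=> sa sb; rewrite (posnegE a) (posnegE b).
have [pa pb] := (summ_posp sa, summ_posp sb).
have [na nb] := (summ_negp sa, summ_negp sb).
rewrite (_ : (fun x => _) = (fun x => (posp a x + posp b x) - (negp a x + negp b x))).
  rewrite !smB ?esD//; [ring|..]; try exact: summD; by move=> x; rewrite addr_ge0.
by apply/funext => x; ring.
Qed.

Lemma smN a : summ a -> sm (fun x => - a x) = - sm a.
Proof.
move=> sa; apply: (@addIr _ (sm a)); rewrite addNr -smD //; last exact: summN.
rewrite (_ : (fun x => _) = (fun=> 0 - 0)); last by apply/funext => x; ring.
by rewrite smB // subrr.
Qed.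

Lemma sm_ge0 a : (forall x, 0 <= a x) -> 0 <= sm a.
Proof.
move=> a0; rewrite /sm /ssum fine_ge0 //.
rewrite [X in (_ - X)%E]esum1 ?sube0.
  by apply: esum_ge0 => x _; exact: funepos_ge0.
by move=> x _; rewrite funenegE; apply/max_idPr; rewrite leeNl oppe0 lee_fin.
Qed.

Lemma ler_sm a b : summ a -> summ b -> (forall x, a x <= b x) -> sm a <= sm b.
Proof.
move=> sa sb ab; rewrite -subr_ge0 -smN // -smD //; last exact: summN.
by apply: sm_ge0 => x; rewrite subr_ge0.
Qed.

Lemma smZ c a : summ a -> sm (fun x => c * a x) = c * sm a.
Proof.
wlog c0 : c / 0 <= c => [H sa|sa].
  have [/H->//|c0] := leP 0 c.
  rewrite -[in RHS](opprK c) mulNr -(H (- c)) // ?oppr_ge0 1?ltW // -smN.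
    by congr sm; apply/funext=> x; ring.
  exact: summZ.
have esZ b : (forall x, 0 <= b x) -> summ b -> es (fun x => c * b x) = c * es b.
  move=> b0 sb; apply: EFin_inj; rewrite EFinM -!esE //; last 2 first.
  - by move=> x; rewrite mulr_ge0.
  - exact: summZ.
  by rewrite -esumZl // => x; rewrite lee_fin.
have [pa na] := (summ_posp sa, summ_negp sa).
have [cpa cna] := (summZ c pa, summZ c na).
have cp0 x : 0 <= c * posp a x by rewrite mulr_ge0.
have cn0 x : 0 <= c * negp a x by rewrite mulr_ge0.
rewrite (posnegE a) smB //.
rewrite (_ : (fun x => _) = (fun x => c * posp a x - c * negp a x)); last first.
  by apply/funext => x; ring.
by rewrite smB // !esZ // mulrBr.
Qed.

Lemma summ_delta c x0 : summ (fun x => c * (x == x0)%:R).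
Proof.
apply: summZ; apply: ge0_summ => // ; rewrite (@esum_delta _ _ _ x0) ?ltry //.
by move=> x /negbTE ->.
Qed.

Lemma sm_delta c x0 : sm (fun x => c * (x == x0)%:R) = c.
Proof.
have s1 : summ (fun x => (x == x0)%:R).
  by have := summ_delta 1 x0; congr summ; apply/funext => x; rewrite mul1r.
rewrite smZ //; apply: EFin_inj; rewrite EFinM -esum_smE //.
rewrite (@esum_delta _ _ _ x0) ?eqxx ?mule1 //.
by move=> x /negbTE ->.
Qed.

End real_sums.
(* Keeps [done] from unfolding suprema when it compares two boundedness goals. *)
Global Opaque sm.

(** * Real inequalities *)

Section reals.
Context {R : realType}.
Implicit Types (a b c e t : R).

Lemma bernoulli_ge c n : 0 <= c -> 1 + c *+ n <= (1 + c) ^+ n.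
Proof.
move=> c0; elim: n => [|n IH]; first by rewrite mulr0n addr0 expr0.
rewrite exprS mulrS; have h : 0 <= c * (c *+ n) by rewrite mulr_ge0 ?mulrn_wge0.
have := ler_wpM2l (addr_ge0 ler01 c0) IH; lra.
Qed.

Lemma expr_small t e : 0 <= t -> t < 1 -> 0 < e -> exists n, t ^+ n < e.
Proof.
rewrite le_eqVlt => /predU1P[<- _ e0|t0 t1 e0]; first by exists 1%N; rewrite expr1.
pose c := t^-1 - 1.
have c0 : 0 < c by rewrite subr_gt0 invf_gt1.
have [n ne] : exists n : nat, e^-1 < c *+ n.
  exists (Num.bound (e^-1 / c)).
  rewrite -mulr_natr mulrC -ltr_pdivrMr //.
  by apply: archi_boundP; rewrite divr_ge0 ?invr_ge0 // ltW.
exists n; rewrite -[t]invrK exprVn invf_plt ?posrE ?exprn_gt0 ?invr_gt0 //.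
have := bernoulli_ge n (ltW c0); rewrite (_ : 1 + c = t^-1); last by rewrite /c; ring.
lra.
Qed.

Lemma ler_norm_sqr a b : 0 <= b -> a ^+ 2 <= b ^+ 2 -> `|a| <= b.
Proof. by move=> b0 ab; rewrite -ler_sqr ?nnegrE // real_normK ?num_real. Qed.

Lemma le0_eps a b : (forall e, 0 < e -> a <= e * b) -> a <= 0.
Proof.
move=> H; rewrite leNgt; apply/negP => a0.
have b0 : 0 < b by have := H 1 ltr01; lra.
have e0 : 0 < a / (2 * b) by rewrite divr_gt0 // mulr_gt0.
have := H _ e0; have -> : a / (2 * b) * b = a / 2 by field; rewrite gt_eqF.
lra.
Qed.

Lemma le0_eps_small a b d : 0 < d ->
  (forall e, 0 < e -> e <= d -> a <= e * b) -> a <= 0.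
Proof.
move=> d0 H; apply: (@le0_eps _ `|b|) => e e0; have b0 := normr_ge0 b.
have [ed|/ltW de] := leP e d.
  by apply: le_trans (H e e0 ed) _; rewrite ler_wpM2l ?ler_norm // ltW.
apply: le_trans (H d d0 (lexx _)) _.
by apply: le_trans (ler_wpM2l (ltW d0) (ler_norm b)) _; rewrite ler_wpM2r.
Qed.

(** With [C = M / (1 - t)], the intervals of radius [C t^n] around [s n] are nested, because
    [C t^n - C t^(n+1) = M t^n]. The supremum of their left ends lies in all of them. *)
Lemma geometric_limit (s : nat -> R) (M t : R) : 0 <= t -> t < 1 ->
  (forall n, `|s n.+1 - s n| <= M * t ^+ n) ->
  exists l, forall n, `|l - s n| <= M / (1 - t) * t ^+ n.
Proof.
move=> t0 t1 sM; set C := M / (1 - t).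
have t1n : 1 - t != 0 by rewrite gt_eqF // subr_gt0.
have CM : C * (1 - t) = M by rewrite /C divfK.
have M0 : 0 <= M.
  by have := le_trans (normr_ge0 _) (sM 0%N); rewrite expr0 mulr1.
have C0 : 0 <= C by rewrite divr_ge0 // subr_ge0 ltW.
have step n : C * t ^+ n - C * t ^+ n.+1 = M * t ^+ n by rewrite -CM exprS; ring.
pose lo n := s n - C * t ^+ n; pose hi n := s n + C * t ^+ n.
have lohi n : lo n <= hi n.
  have h : 0 <= C * t ^+ n by rewrite mulr_ge0 ?exprn_ge0.
  by rewrite /lo /hi; lra.
have loS n : lo n <= lo n.+1.
  by have := sM n; have := step n; rewrite ler_norml /lo => ? /andP[? ?]; lra.
have hiS n : hi n.+1 <= hi n.
  by have := sM n; have := step n; rewrite ler_norml /hi => ? /andP[? ?]; lra.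
have lom n m : (n <= m)%N -> lo n <= lo m.
  elim: m => [|m IH]; first by rewrite leqn0 => /eqP ->.
  by rewrite leq_eqVlt => /predU1P[->//|/IH/le_trans]; apply.
have him n m : (n <= m)%N -> hi m <= hi n.
  elim: m => [|m IH]; first by rewrite leqn0 => /eqP ->.
  rewrite leq_eqVlt => /predU1P[->//|/IH]; exact: le_trans (hiS m).
have lh n m : lo n <= hi m.
  apply: le_trans (lom _ _ (leq_maxl n m)) _.
  exact: le_trans (lohi _) (him _ _ (leq_maxr n m)).
have hu : has_ubound (range lo) by exists (hi 0%N) => _ [n _ <-].
exists (sup (range lo)) => n; rewrite ler_norml; apply/andP; split.
  have h : lo n <= sup (range lo) by apply: ub_le_sup => //; exists n.
  by rewrite /lo in h; lra.
suff : sup (range lo) <= hi n by rewrite /hi; lra.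
by apply: ge_sup; [exists (lo 0%N); exists 0%N|move=> _ [m _ <-]].
Qed.

Lemma discriminant_le a b c : 0 <= c ->
  (forall s, 0 <= a - 2 * s * b + s ^+ 2 * c) -> b ^+ 2 <= a * c.
Proof.
rewrite le_eqVlt => /predU1P[<- H|c0 H]; last first.
  have cn : c != 0 by rewrite gt_eqF.
  have := mulr_ge0 (ltW c0) (H (b / c)).
  have -> : c * (a - 2 * (b / c) * b + (b / c) ^+ 2 * c) = a * c - b ^+ 2 by field.
  by rewrite subr_ge0.
have [->|bn] := eqVneq b 0; first by rewrite expr0n /= mulr0.
(* For [c = 0] the form is affine in [s]; this [s] makes it equal to -1. *)
have := H ((a + 1) / (2 * b)).
have -> : a - 2 * ((a + 1) / (2 * b)) * b + ((a + 1) / (2 * b)) ^+ 2 * 0 = -1.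
  by field.
by rewrite oppr_ge0 ler10.
Qed.

End reals.

(** * Expectations of bounded functions *)

Section bounded.
Context {R : realType} {T : Type}.
Implicit Types (u v : T -> R).

Definition bnd u : Prop := exists M, forall x, `|u x| <= M.

Lemma bndP u : bnd u -> exists M, 0 <= M /\ forall x, `|u x| <= M.
Proof.
move=> [M uM]; exists `|M|; split => // x.
exact: le_trans (uM x) (ler_norm M).
Qed.

Lemma bnd_itv a b u : (forall x, a <= u x <= b) -> bnd u.
Proof.
move=> uab; exists (`|a| + `|b|) => x; have /andP[au ub] := uab x.
have ha := ler_norm (- a); have hb := ler_norm b; rewrite normrN in ha.
have := normr_ge0 a; have := normr_ge0 b.
by rewrite ler_norml => ? ?; apply/andP; split; lra.
Qed.

Lemma bnd_cst (c : R) : bnd (fun=> c).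
Proof. by exists `|c|. Qed.

Lemma bndD u v : bnd u -> bnd v -> bnd (fun x => u x + v x).
Proof.
move=> [M uM] [N vN]; exists (M + N) => x.
exact: le_trans (ler_normD _ _) (lerD _ _).
Qed.

Lemma bndN u : bnd u -> bnd (fun x => - u x).
Proof. by move=> [M uM]; exists M => x; rewrite normrN. Qed.

Lemma bndM u v : bnd u -> bnd v -> bnd (fun x => u x * v x).
Proof.
move=> [M uM] [N vN]; exists (M * N) => x.
by rewrite normrM ler_pM.
Qed.

Lemma bndX u n : bnd u -> bnd (fun x => u x ^+ n).
Proof.
move=> bu; elim: n => [|n IH]; first exact: bnd_cst.
rewrite (_ : (fun _ => _) = (fun x => u x * u x ^+ n)); first exact: bndM.
by apply/funext => x; rewrite exprS.
Qed.

Lemma bnd_norm u : bnd u -> bnd (fun x => `|u x|).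
Proof. by move=> [M uM]; exists M => x; rewrite normr_id. Qed.

Lemma bnd_max u v : bnd u -> bnd v -> bnd (fun x => Num.max (u x) (v x)).
Proof.
move=> /bndP[M [M0 uM]] /bndP[N [N0 vN]]; exists (M + N) => x.
by have := uM x; have := vN x; case: (leP (u x) (v x)) => *; lra.
Qed.

Lemma bnd_sqrt u : bnd u -> bnd (fun x => Num.sqrt (u x)).
Proof.
move=> [M uM]; exists (Num.sqrt M) => x; rewrite ger0_norm ?sqrtr_ge0 //.
by rewrite ler_wsqrtr // (le_trans (ler_norm _)).
Qed.

Lemma bndV d u : 0 < d -> (forall x, d <= u x) -> bnd (fun x => (u x)^-1).
Proof.
move=> d0 du; exists d^-1 => x.
have u0 : 0 < u x := lt_le_trans d0 (du x).
rewrite ger0_norm ?invr_ge0; last exact: ltW.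
by rewrite lef_pV2.
Qed.

End bounded.

(** Boundedness is the side condition of the rules for expectations; [bd] reads it off the shape of
    the function. *)
Ltac bd_step := lazymatch goal with
  | |- bnd (fun _ => ?c) => exact (bnd_cst c)
  | |- bnd (fun x => @?a x + @?b x) => apply: bndD
  | |- bnd (fun x => - (@?a x)) => apply: bndN
  | |- bnd (fun x => (@?a x) ^+ ?n) => apply: bndX
  | |- bnd (fun x => @?a x * @?b x) => apply: bndM
  | |- bnd (fun x => `|@?a x|) => apply: bnd_norm
  | |- bnd (fun x => Num.max (@?a x) (@?b x)) => apply: bnd_max
  | |- bnd (fun x => Num.sqrt (@?a x)) => apply: bnd_sqrt
  | |- bnd _ => assumption end.
Ltac bd := solve [repeat bd_step].

Section expectation.
Context {R : realType} {T : countType} {w : T -> R}.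
Hypothesis w_prob : is_prob w.
Implicit Types (u v : T -> R).

Definition expect (w : T -> R) u : R := sm (fun x => u x * w x).

Lemma prob_ge0 x : 0 <= w x. Proof. exact: w_prob.1. Qed.

Lemma prob_gt0 : exists x, 0 < w x.
Proof.
apply/not_existsP => N; have := w_prob.2; rewrite esum1 => [/esym/eqP|y _].
  by rewrite onee_eq0.
by apply/eqP; rewrite eqe eq_le prob_ge0 andbT leNgt; apply/negP/N.
Qed.

Lemma summ_prob : summ w.
Proof.
apply: ge0_summ; first exact: prob_ge0.
by rewrite w_prob.2 ltry.
Qed.

Lemma prob_le1 x : w x <= 1.
Proof.
rewrite -lee_fin -w_prob.2; apply: (@esum_fin_ge _ _ (EFin \o w)) => y.
by rewrite lee_fin prob_ge0.
Qed.

Lemma summ_ex u : bnd u -> summ (fun x => u x * w x).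
Proof.
move=> [M uM]; apply: (summ_le (summZ M summ_prob)) => x.
by rewrite normrM (ger0_norm (prob_ge0 x)) ler_wpM2r ?prob_ge0.
Qed.

Lemma eq_ex u v : u =1 v -> expect w u = expect w v.
Proof. by move=> uv; congr expect; apply/funext. Qed.

Lemma exD u v : bnd u -> bnd v -> expect w (fun x => u x + v x) = expect w u + expect w v.
Proof.
move=> bu bv; rewrite /expect -smD; try exact: summ_ex.
by congr sm; apply/funext => x; rewrite mulrDl.
Qed.

Lemma exN u : bnd u -> expect w (fun x => - u x) = - expect w u.
Proof.
move=> bu; rewrite /expect -smN; last exact: summ_ex.
by congr sm; apply/funext => x; rewrite mulNr.
Qed.

Lemma exB u v : bnd u -> bnd v -> expect w (fun x => u x - v x) = expect w u - expect w v.
Proof. by move=> bu bv; rewrite exD ?exN //; exact: bndN. Qed.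

Lemma exZ c u : bnd u -> expect w (fun x => c * u x) = c * expect w u.
Proof.
move=> bu; rewrite /expect -smZ; last exact: summ_ex.
by congr sm; apply/funext => x; rewrite mulrA.
Qed.

Lemma ex_cst c : expect w (fun=> c) = c.
Proof.
rewrite /expect smZ; last exact: summ_prob.
suff -> : sm w = 1 by rewrite mulr1.
apply: EFin_inj; rewrite -esum_smE ?w_prob.2 //; last exact: summ_prob.
exact: prob_ge0.
Qed.

Lemma ex_ge0 u : (forall x, 0 <= u x) -> 0 <= expect w u.
Proof. by move=> u0; apply: sm_ge0 => x; rewrite mulr_ge0 ?prob_ge0. Qed.

Lemma ler_ex u v : bnd u -> bnd v -> (forall x, u x <= v x) -> expect w u <= expect w v.
Proof.
move=> bu bv uv; apply: ler_sm; try exact: summ_ex.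
by move=> x; rewrite ler_wpM2r ?prob_ge0.
Qed.

Lemma ler_ex_supp u v : bnd u -> bnd v ->
  (forall x, 0 < w x -> u x <= v x) -> expect w u <= expect w v.
Proof.
move=> bu bv uv; apply: ler_sm; try exact: summ_ex.
move=> x; have := prob_ge0 x; rewrite le_eqVlt => /predU1P[<-|w0].
  by rewrite !mulr0.
by rewrite ler_pM2r // uv.
Qed.

Lemma ex_itv a b u : (forall x, a <= u x <= b) -> a <= expect w u <= b.
Proof.
move=> uab; have bu := bnd_itv uab.
by apply/andP; split; [rewrite -(ex_cst a)|rewrite -[leRHS](ex_cst b)];
  apply: ler_ex => //; try exact: bnd_cst; move=> x; have /andP[] := uab x.
Qed.

Lemma ex_le b u : bnd u -> (forall x, u x <= b) -> expect w u <= b.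
Proof.
by move=> bu ub; rewrite -(ex_cst b); apply: ler_ex => //; exact: bnd_cst.
Qed.

Lemma ler_norm_ex M u : (forall x, `|u x| <= M) -> `|expect w u| <= M.
Proof.
move=> uM; rewrite ler_norml; apply: ex_itv => x.
by rewrite -ler_norml.
Qed.

Lemma ex_esum u : bnd u -> (forall x, 0 <= u x) ->
  (\esum_(x in setT) (u x * w x)%:E)%E = (expect w u)%:E.
Proof.
move=> bu u0; rewrite esum_smE //; last exact: summ_ex.
by move=> x; rewrite mulr_ge0 ?prob_ge0.
Qed.

Lemma ex_delta u x0 : expect w (fun x => u x * (x == x0)%:R) = u x0 * w x0.
Proof.
rewrite /expect -(sm_delta (u x0 * w x0) x0); congr sm; apply/funext => x.
by case: eqVneq => [->|_]; rewrite ?mulr1 // !mulr0 mul0r.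
Qed.

Lemma ex_point u x0 : bnd u -> (forall x, 0 <= u x) -> u x0 * w x0 <= expect w u.
Proof.
move=> bu u0; rewrite -ex_delta //; apply: ler_ex => //.
  case: bu => M uM; exists M => x.
  by case: eqP; rewrite ?mulr1 ?mulr0 ?normr0 // (le_trans _ (uM x)).
by move=> x; case: eqP; rewrite ?mulr1 ?mulr0.
Qed.

Lemma ex_sqr u : bnd u -> expect w u ^+ 2 <= expect w (fun x => u x ^+ 2).
Proof.
move=> bu; set m := expect w u.
have : 0 <= expect w (fun x => (u x - m) ^+ 2) by apply: ex_ge0 => x; exact: sqr_ge0.
rewrite (@eq_ex _ (fun x => u x ^+ 2 - (2 * m) * u x + m ^+ 2)); last first.
  by move=> x; ring.
rewrite exD ?exB ?exZ ?ex_cst -/m; try bd.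
by move=> ?; nra.
Qed.

End expectation.

Section bnd_ex.
Context {R : realType} {T : countType} {T' : Type}.

Lemma bnd_ex (S : T' -> T -> R) (U : T' -> T -> R) :
  (forall x, is_prob (S x)) -> (exists M, forall x y, `|U x y| <= M) ->
  bnd (fun x => expect (S x) (U x)).
Proof. by move=> HS [M UM]; exists M => x; exact: ler_norm_ex. Qed.

Lemma bnd_ex1 (S : T' -> T -> R) (u : T -> R) :
  (forall x, is_prob (S x)) -> bnd u -> bnd (fun x => expect (S x) u).
Proof. by move=> HS [M UM]; apply: bnd_ex => //; exists M. Qed.

End bnd_ex.

(* From [x0], draw [z] according to [w] and go there with probability [phi z];
   otherwise stay at [x0]. *)
Section redirect.
Context {R : realType} {T : countType} {w phi : T -> R}.
Hypothesis w_prob : is_prob w.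
Hypothesis phi_bnd : bnd phi.
Hypothesis phi_ge0 : forall z, 0 <= phi z.
Hypothesis phi_le1 : expect w phi <= 1.
Context (x0 : T).

Definition redirect (w phi : T -> R) x0 z : R :=
  phi z * w z + (1 - expect w phi) * (z == x0)%:R.

Let redirect_ge0 z : 0 <= redirect w phi x0 z.
Proof.
by rewrite addr_ge0 // mulr_ge0 ?(prob_ge0 w_prob) ?subr_ge0 // ler0n.
Qed.

Let summ_redirect : summ (redirect w phi x0).
Proof. by apply: summD; [exact: summ_ex|exact: summ_delta]. Qed.

Let sm_redirect (u : T -> R) : bnd u ->
  sm (fun z => u z * redirect w phi x0 z) =
  expect w (fun z => phi z * u z) + (1 - expect w phi) * u x0.
Proof.
move=> bu; rewrite /expect -(sm_delta ((1 - sm _) * u x0) x0) -smD.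
- congr sm; apply/funext => z; rewrite /redirect /expect.
  by case: eqVneq => [->|_] /=; ring.
- by apply: (summ_ex w_prob); bd.
- exact: summ_delta.
Qed.

Lemma redirect_prob : is_prob (redirect w phi x0).
Proof.
split => //; rewrite esum_smE //.
have := sm_redirect (bnd_cst 1).
rewrite (_ : (fun z => 1 * _) = redirect w phi x0); last first.
  by apply/funext => z; rewrite mul1r.
move=> ->; rewrite (_ : (fun z => phi z * 1) = phi); last first.
  by apply/funext => z; rewrite mulr1.
by congr EFin; ring.
Qed.

Lemma ex_redirect u : bnd u -> expect (redirect w phi x0) u =
  expect w (fun z => phi z * u z) + (1 - expect w phi) * u x0.
Proof. exact: sm_redirect. Qed.

End redirect.

Section fubini.
Context {R : realType} {X Y : countType}.

Lemma ex_ex_esum (w : X -> R) (S : X -> Y -> R) (U : X -> Y -> R) :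
  is_prob w -> (forall x, is_prob (S x)) ->
  (exists M, forall x y, `|U x y| <= M) -> (forall x y, 0 <= U x y) ->
  (expect w (fun x => expect (S x) (U x)))%:E =
  (\esum_(x in setT) \esum_(y in setT) (U x y * S x y * w x)%:E)%E.
Proof.
move=> Hw HS bU U0.
have B : bnd (fun x => expect (S x) (U x)) by exact: bnd_ex.
have P x : 0 <= expect (S x) (U x) by exact: ex_ge0.
rewrite -ex_esum //.
have BU x : bnd (U x) by case: bU => M UM; exists M.
apply: eq_esum => x _; rewrite mulrC EFinM -ex_esum //.
rewrite -esumZl; last 2 first.
- exact: prob_ge0.
- by move=> y; rewrite lee_fin mulr_ge0 //; exact: prob_ge0.
by apply: eq_esum => y _; rewrite -EFinM mulrC.
Qed.

End fubini.

Section exchange.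
Context {R : realType} {X Y : countType}.

Lemma ex_exchange (w : X -> R) (S : X -> Y -> R) (w' : Y -> R) (S' : Y -> X -> R)
    (U : X -> Y -> R) :
  is_prob w -> (forall x, is_prob (S x)) -> is_prob w' -> (forall y, is_prob (S' y)) ->
  (forall x y, S x y * w x = S' y x * w' y) ->
  (exists M, forall x y, `|U x y| <= M) ->
  expect w (fun x => expect (S x) (U x)) = expect w' (fun y => expect (S' y) (fun x => U x y)).
Proof.
move=> Hw HS Hw' HS' E bU.
(* Sums may be exchanged for nonnegative terms. Adding the bound [M] to [U] makes it nonnegative and
   adds [M] to both sides, all weights being probabilities. *)
wlog U0 : U bU / forall x y, 0 <= U x y => [H|].
  have [M UM] := bU.
  have B1 x : bnd (U x) by exists M.
  have B2 y : bnd (fun x => U x y) by exists M.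
  have := H (fun x y => U x y + M) _ _.
  have -> : (fun x => expect (S x) (fun y => U x y + M)) = (fun x => expect (S x) (U x) + M).
    by apply/funext => x; rewrite exD ?ex_cst //; exact: bnd_cst.
  have -> : (fun y => expect (S' y) (fun x => U x y + M)) =
      (fun y => expect (S' y) (fun x => U x y) + M).
    by apply/funext => x; rewrite exD ?ex_cst //; exact: bnd_cst.
  rewrite !exD ?ex_cst //; try exact: bnd_cst.
  - move=> /(_ _ _)/addIr; apply.
    + exists (M + `|M|) => x y; apply: le_trans (ler_normD _ _) _; exact: lerD.
    + by move=> x y; have := UM x y; rewrite ler_norml => /andP[? _]; lra.
  - by apply: bnd_ex => //; exists M.
  - by apply: bnd_ex => //; exists M.
have bU' : exists M, forall y x, `|U x y| <= M by case: bU => M UM; exists M.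
apply: EFin_inj; rewrite (ex_ex_esum (U := U)) // (ex_ex_esum (U := fun y x => U x y)) //.
rewrite (esum_exchange (a := fun x y => (U x y * S x y * w x)%:E)); last first.
  by move=> x y; rewrite lee_fin !mulr_ge0 //; exact: prob_ge0.
by apply: eq_esum => y _; apply: eq_esum => x _; rewrite -!mulrA E.
Qed.

(** The law after one step of the kernel [S] started from [w]. *)
Definition compw (w : X -> R) (S : X -> Y -> R) (y : Y) : R := expect w (fun x => S x y).

Context (w : X -> R) (S : X -> Y -> R) (w_prob : is_prob w)
  (S_markov : forall x, is_prob (S x)).

Let compw_ge0 y : 0 <= compw w S y.
Proof. by apply: ex_ge0 => // x; exact: prob_ge0. Qed.

Let compwE (u : Y -> R) : bnd u -> (forall y, 0 <= u y) ->
  (\esum_(y in setT) (u y * compw w S y)%:E)%E = (expect w (fun x => expect (S x) u))%:E.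
Proof.
move=> bu u0.
have bU : exists M, forall (x : X) y, `|u y| <= M by case: bu => M uM; exists M.
rewrite ex_ex_esum //.
rewrite esum_exchange; last first.
  by move=> x y; rewrite lee_fin !mulr_ge0 //; exact: prob_ge0.
have bS y : bnd (fun x => S x y).
  by apply: (@bnd_itv _ _ 0 1) => x; rewrite prob_ge0 ?prob_le1.
apply: eq_esum => y _; rewrite EFinM -ex_esum //; last by move=> x; exact: prob_ge0.
rewrite -esumZl //; last by move=> x; rewrite lee_fin mulr_ge0 //; exact: prob_ge0.
by apply: eq_esum => x _; rewrite -EFinM mulrA.
Qed.

Lemma compw_prob : is_prob (compw w S).
Proof.
split => //.
have -> : (\esum_(y in setT) (compw w S y)%:E = \esum_(y in setT) (1 * compw w S y)%:E)%E.
  by apply: eq_esum => y _; rewrite mul1r.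
rewrite (compwE (bnd_cst 1)) // (_ : (fun x => _) = (fun=> 1)) ?ex_cst //.
by apply/funext => x; rewrite ex_cst.
Qed.

Lemma ex_compw u : bnd u -> expect (compw w S) u = expect w (fun x => expect (S x) u).
Proof.
move=> bu; have Hp := compw_prob.
wlog u0 : u bu / forall y, 0 <= u y => [H|].
  have [M uM] := bu.
  have := H (fun y => u y + M) _ _.
  have -> : (fun x => expect (S x) (fun y => u y + M)) = (fun x => expect (S x) u + M).
    by apply/funext => x; rewrite exD ?ex_cst //; exact: bnd_cst.
  rewrite !exD ?ex_cst //; try exact: bnd_cst.
  - move=> /(_ _ _)/addIr; apply; first by bd.
    by move=> x; have := uM x; rewrite ler_norml => /andP[? _]; lra.
  - exact: bnd_ex1.
apply: EFin_inj; rewrite -(ex_esum Hp) //; exact: compwE.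
Qed.

End exchange.

(** * Curvature conditions for bounded functions *)

Section markov_operators.
Context {R : realType} {X : countType}.
Implicit Types (u v : X -> R).

Definition mean (K : X -> X -> R) u x : R := expect (K x) u.
Definition lap (K : X -> X -> R) u x : R := mean K u x - u x.
Definition gam (K : X -> X -> R) u v x : R :=
  2^-1 * mean K (fun y => (u y - u x) * (v y - v x)) x.

Context {K : X -> X -> R}.
Hypothesis K_markov : markov_kernel K.

Lemma bnd_mean u : bnd u -> bnd (mean K u).
Proof. exact: bnd_ex1. Qed.

Lemma bnd_lap u : bnd u -> bnd (lap K u).
Proof. by move=> bu; apply: bndD; [exact: bnd_mean|exact: bndN]. Qed.

Lemma ler_norm_gam u v M N : (forall x, `|u x| <= M) -> (forall x, `|v x| <= N) ->
  forall x, `|gam K u v x| <= 2 * M * N.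
Proof.
move=> uM vN x.
rewrite /gam normrM ger0_norm ?invr_ge0 // ler_pdivrMl //.
apply: (ler_norm_ex (K_markov x)) => y; rewrite normrM.
have -> : 2 * (2 * M * N) = (M + M) * (N + N) by ring.
by apply: ler_pM => //; apply: le_trans (ler_normB _ _) _; apply: lerD.
Qed.

Lemma bnd_gam u v : bnd u -> bnd v -> bnd (gam K u v).
Proof.
by move=> [M uM] [N vN]; exists (2 * M * N); exact: ler_norm_gam.
Qed.

Lemma gam_ge0 u x : 0 <= gam K u u x.
Proof.
rewrite mulr_ge0 ?invr_ge0 //; apply: (ex_ge0 (K_markov x)) => y.
by rewrite -expr2 sqr_ge0.
Qed.

(** [lap] and [gam] become opaque below; this and [gam_def] are their unfolding equations. *)
Lemma lapE u x : lap K u x = mean K u x - u x.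
Proof. by []. Qed.

Lemma gam_def u v x :
  gam K u v x = 2^-1 * mean K (fun y => (u y - u x) * (v y - v x)) x.
Proof. by []. Qed.

End markov_operators.
Global Opaque lap gam.

Ltac bd_step ::= lazymatch goal with
  | |- bnd (fun _ => ?c) => exact (bnd_cst c)
  | |- bnd (fun x => @?a x + @?b x) => apply: bndD
  | |- bnd (fun x => - (@?a x)) => apply: bndN
  | |- bnd (fun x => (@?a x) ^+ ?n) => apply: bndX
  | |- bnd (fun x => @?a x * @?b x) => apply: bndM
  | |- bnd (fun x => `|@?a x|) => apply: bnd_norm
  | |- bnd (fun x => Num.max (@?a x) (@?b x)) => apply: bnd_max
  | |- bnd (fun x => Num.sqrt (@?a x)) => apply: bnd_sqrt
  | |- bnd (fun x => gam ?k ?u ?v x) => apply: bnd_gam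
  | |- bnd (fun x => lap ?k ?u x) => apply: bnd_lap
  | |- bnd (fun x => mean ?k ?u x) => apply: bnd_mean
  | |- bnd (gam _ _ _) => apply: bnd_gam
  | |- bnd (lap _ _) => apply: bnd_lap
  | |- bnd (mean _ _) => apply: bnd_mean
  | |- markov_kernel _ => assumption
  | |- bnd _ => assumption end.

Section cd.
Context {R : realType} {X : countType} {K : X -> X -> R}.
Hypothesis K_markov : markov_kernel K.
Implicit Types (u v : X -> R).

Lemma gamE u v x : bnd u -> bnd v ->
  gam K u v x = 2^-1 * (mean K (fun y => u y * v y) x - u x * mean K v x
                        - v x * mean K u x + u x * v x).
Proof.
move=> bu bv; rewrite !gam_def /mean; congr (_ * _).
rewrite (@eq_ex _ _ _ _ (fun y => u y * v y - u x * v y - v x * u y + u x * v x)).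
  by rewrite (exD (K_markov x)) ?exB ?exZ ?ex_cst //; bd.
by move=> y; ring.
Qed.

Lemma lap_affine a e u x : bnd u -> lap K (fun y => a + e * u y) x = e * lap K u x.
Proof.
move=> bu; rewrite !lapE /mean (exD (K_markov x)) ?exZ ?ex_cst //; try bd.
by ring.
Qed.

Lemma gam_affine a e u v x : bnd u -> bnd v ->
  gam K (fun y => a + e * u y) v x = e * gam K u v x.
Proof.
move=> bu bv; rewrite !gam_def /mean mulrCA -[e * expect _ _](exZ (K_markov x)); last bd.
by congr (_ * _); apply: eq_ex => y; ring.
Qed.

Lemma gamC u v x : gam K u v x = gam K v u x.
Proof. by rewrite !gam_def; congr (_ * _); apply: eq_ex => y; rewrite mulrC. Qed.

Lemma gamZr e u v x : bnd u -> bnd v ->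
  gam K u (fun y => e * v y) x = e * gam K u v x.
Proof.
move=> bu bv; rewrite gamC (_ : (fun y => e * v y) = (fun y => 0 + e * v y)).
  by rewrite gam_affine // gamC.
by apply/funext => y; rewrite add0r.
Qed.

Lemma gen_real u x : bnd u -> gen K (EFin \o u) x = (lap K u x)%:E.
Proof.
move=> bu; rewrite /gen.
have E : lap K u x = sm (fun y => (u y - u x) * K x y).
  rewrite -[RHS]/(expect (K x) (fun y => u y - u x)).
  by rewrite (exB (K_markov x)) ?ex_cst //; bd.
by rewrite E -ssumE //; apply: (summ_ex (K_markov x)); bd.
Qed.

Lemma cdc_real u v x : bnd u -> bnd v ->
  cdc K (EFin \o u) (EFin \o v) x = (gam K u v x)%:E.
Proof.
move=> bu bv; rewrite /cdc gam_def EFinM /mean /expect -ssumE //.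
by apply: (summ_ex (K_markov x)); bd.
Qed.

Lemma Gamma_real u : bnd u -> Gamma K (EFin \o u) = EFin \o gam K u u.
Proof. by move=> bu; apply/funext => x; rewrite /Gamma cdc_real. Qed.

Context {kappa : R}.
Hypothesis K_CDE' : CDE' K kappa.

(** The lower bound [d] keeps [gam K u u / u] bounded, so every sum in [tGamma2] converges
    absolutely, [Gamma2_defined] holds, and the condition becomes an inequality between reals. *)
Lemma CDE'_real d u x : bnd u -> 0 < d -> (forall y, d <= u y) ->
  kappa * gam K u u x <=
  2^-1 * lap K (gam K u u) x - gam K u (lap K u) x
  - gam K u (fun y => gam K u u y / u y) x.
Proof.
move=> bu d0 du.
have u0 y : 0 < u y := lt_le_trans d0 (du y).
have bV : bnd (fun y => (u y)^-1) by exact: bndV du.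
have := K_CDE' (fun y => ltW (u0 y)) (x := x).
rewrite /Gamma2_defined /tGamma2 /Gamma2 !Gamma_real //.
have -> : (gen K (EFin \o u) = EFin \o lap K u)%E.
  by apply/funext => y; rewrite gen_real.
have -> : (fun y => (EFin \o gam K u u) y / (EFin \o u) y)%E =
          EFin \o (fun y => gam K u u y / u y).
  by apply/funext => y /=; rewrite inver gt_eqF.
have bl := bnd_lap K_markov bu; have bg := bnd_gam K_markov bu bu.
have bgu : bnd (fun y => gam K u u y / u y) by bd.
rewrite gen_real // !cdc_real //.
rewrite -!EFinM -!EFinB !lee_fin; apply; split; first by rewrite ltry.
have := ex_esum (K_markov x) (bnd_gam K_markov bu bu) (gam_ge0 K_markov u).
have -> : (\esum_(y in setT) ((EFin \o gam K u u) y * (K x y)%:E) =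
           \esum_(y in setT) (gam K u u y * K x y)%:E)%E.
  by apply: eq_esum => y _; rewrite EFinM.
by move=> ->; rewrite ltry.
Qed.

Lemma CD_real u x : bnd u ->
  kappa * gam K u u x <= 2^-1 * lap K (gam K u u) x - gam K u (lap K u) x.
Proof.
move=> /[dup] bu /bndP[M [M0 uM]].
rewrite -subr_le0; set a := (X in X <= 0).
(* The condition on [e] keeps [1 + e u] above 1/2, so Gamma(u) divided by it is at most [2 M^2 * 2],
   and the extra term, once divided by [e^2], is at most [e * (2 M) * (4 M^2)]. *)
suff H e : 0 < e -> e * (M + 1) <= 2^-1 -> a <= e * (8 * M ^+ 3).
  apply: (@le0_eps_small _ _ (8 * M ^+ 3) (2 * (M + 1))^-1).
    by rewrite invr_gt0 mulr_gt0 // ltr_wpDl.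
  move=> e e0 eM; apply: H => //.
  by move: eM; rewrite invfM -ler_pdivlMr ?ltr_wpDl.
(* CDE' for [1 + e * u]: the extra term of [tGamma2] is of order [e ^ 3]. *)
move=> e0 eM; pose f y := 1 + e * u y.
have fl y : 2^-1 <= f y.
  have := uM y; rewrite ler_norml => /andP[u1 _].
  by rewrite /f; nra.
have bf : bnd f by rewrite /f; bd.
have bV : bnd (fun y => (f y)^-1) by apply: (bndV _ fl).
have := CDE'_real x bf _ fl.
have gf v y : bnd v -> gam K f v y = e * gam K u v y by move=> bv; exact: (gam_affine 1 e y bu bv).
have gff : gam K f f = (fun y => e ^+ 2 * gam K u u y).
  by apply/funext => y; rewrite gf // gamC gf // mulrA -expr2.
have lf : lap K f = (fun y => e * lap K u y) by apply/funext => y; exact: (lap_affine 1 e y bu).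
have bg : bnd (fun y => gam K u u y / f y) by bd.
have -> : (fun y => gam K f f y / f y) = (fun y => e ^+ 2 * (gam K u u y / f y)).
  by apply/funext => y; rewrite gff /= -mulrA.
rewrite gff lf !gf; try bd.
have -> : lap K (fun y => e ^+ 2 * gam K u u y) x = e ^+ 2 * lap K (gam K u u) x.
  rewrite -(@lap_affine 0) //; last bd.
  by congr (lap K _ x); apply/funext => y; rewrite add0r.
rewrite !gamZr //; try bd.
have hC : `|gam K u (fun y => gam K u u y / f y) x| <= 2 * M * (4 * M ^+ 2).
  apply: ler_norm_gam => // y; rewrite normrM.
  have f0 : 0 < f y by apply: lt_le_trans (fl y); rewrite invr_gt0.
  have h : `|(f y)^-1| <= 2.
    rewrite ger0_norm ?invr_ge0 ?(ltW f0) // -[leRHS]invrK lef_pV2 ?posrE //.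
  have -> : 4 * M ^+ 2 = (2 * M * M) * 2 by ring.
  by apply: ler_pM => //; exact: ler_norm_gam.
move=> /(_ _); rewrite invr_gt0 => /(_ (ltr0Sn _ 1)).
move: hC; rewrite ler_norml /a => /andP[h1 h2] h.
have e2 : 0 < e ^+ 2 by rewrite exprn_gt0.
rewrite -(ler_pM2l e2).
have h3 := ler_wpM2l (ltW (mulr_gt0 e0 e2)) h1.
move: h h3; set G := gam K u _ x; set A := gam K u u x; set B := lap K _ x; set D := gam K u _ x.
by rewrite !exprS expr0; lra.
Qed.

End cd.

(** * Resolvent and gradient estimate *)

Section cauchy_schwarz.
Context {R : realType} {T : countType} {w : T -> R}.
Hypothesis w_prob : is_prob w.

Lemma ex_cauchy_schwarz (u v : T -> R) : bnd u -> bnd v ->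
  expect w (fun x => u x * v x) ^+ 2 <=
  expect w (fun x => u x ^+ 2) * expect w (fun x => v x ^+ 2).
Proof.
move=> bu bv; apply: discriminant_le => [|s].
  by apply: ex_ge0 => // x; exact: sqr_ge0.
have : 0 <= expect w (fun x => (u x - s * v x) ^+ 2) by apply: ex_ge0 => // x; exact: sqr_ge0.
rewrite (@eq_ex _ _ _ _ (fun x => u x ^+ 2 - (2 * s) * (u x * v x) + s ^+ 2 * v x ^+ 2)).
  by rewrite (exD w_prob) ?exB ?exZ //; bd.
by move=> x; ring.
Qed.

End cauchy_schwarz.

Section resolvent.
Context {R : realType} {X : countType} {K : X -> X -> R}.
Hypothesis K_markov : markov_kernel K.
Implicit Types (u v g : X -> R) (h : R).

Lemma ler_dist_mean u v M x : bnd u -> bnd v -> (forall y, `|u y - v y| <= M) ->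
  `|mean K u x - mean K v x| <= M.
Proof.
by move=> bu bv uvM; rewrite /mean -(exB (K_markov x)) //; exact: ler_norm_ex.
Qed.

(** The equation reads [u = (g + h * mean K u) / (1 + h)], and the right-hand side is a contraction
    of factor [h / (1 + h)] for the uniform norm. *)
Lemma resolvent_exists h g : 0 < h -> bnd g ->
  exists2 u, bnd u & forall x, u x - h * lap K u x = g x.
Proof.
move=> h0 bg; have h1 : 0 < 1 + h by rewrite ltr_wpDl.
have h1n : 1 + h != 0 by rewrite gt_eqF.
pose F u x := (g x + h * mean K u x) / (1 + h).
pose s n := iter n F (fun=> 0).
have bF u : bnd u -> bnd (F u) by move=> bu; rewrite /F; bd.
have bs n : bnd (s n) by elim: n => [|n IH]; [exact: bnd_cst|exact: bF].
pose t := h / (1 + h).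
have t0 : 0 <= t by rewrite divr_ge0 // ltW.
have t1 : t < 1 by rewrite ltr_pdivrMr // mul1r ltrDr.
have Ft u v M : bnd u -> bnd v -> (forall x, `|u x - v x| <= M) ->
    forall x, `|F u x - F v x| <= t * M.
  move=> bu bv uvM x.
  have -> : F u x - F v x = t * (mean K u x - mean K v x) by rewrite /F /t; field.
  by rewrite normrM ger0_norm // ler_wpM2l // ler_dist_mean.
have [M sM] : bnd (s 1%N) by [].
have sS n x : `|s n.+1 x - s n x| <= M * t ^+ n.
  elim: n x => [x|n IH x]; first by rewrite expr0 mulr1 subr0.
  have -> : M * t ^+ n.+1 = t * (M * t ^+ n) by rewrite exprS; ring.
  exact: (Ft (s n.+1) (s n) _ (bs _) (bs _) IH).
have [u uP] := choice (fun x => geometric_limit t0 t1 (fun n => sS n x)).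
pose C := M / (1 - t); have us n x : `|u x - s n x| <= C * t ^+ n by exact: uP.
have bu : bnd u by exists C => x; have := us 0%N x; rewrite subr0 expr0 mulr1.
exists u => // x; apply/eqP; rewrite -subr_eq0 -normr_eq0 eq_le normr_ge0 andbT.
apply: (@le0_eps _ _ (2 * h)) => e e0.
have [n Cn] : exists n, C * t ^+ n <= e.
  have C0 : 0 <= C by have := le_trans (normr_ge0 _) (us 0%N x); rewrite expr0 mulr1.
  have [|n tn] := expr_small t0 t1 (e := e / (C + 1)).
    by rewrite divr_gt0 // ltr_wpDl.
  exists n; move: tn; rewrite ltr_pdivlMr ?ltr_wpDl // => tn.
  by have := exprn_ge0 n t0; nra.
have usn := us n.
have d1 : `|u x - s n.+1 x| <= t * (C * t ^+ n).
  by rewrite (_ : t * _ = C * t ^+ n.+1) //; rewrite exprS; ring.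
have d2 : `|mean K u x - mean K (s n) x| <= C * t ^+ n by exact: ler_dist_mean.
(* As [s n.+1 = F (s n)], the residual of the limit only involves its distances to [s n] and
   [s n.+1]. Since [(1 + h) * t = h], each part is at most [h * (C * t ^+ n)]. *)
have -> : u x - h * lap K u x - g x =
    (1 + h) * (u x - s n.+1 x) - h * (mean K u x - mean K (s n) x).
  by rewrite /= -/(s n) /F lapE; field.
have d1' : (1 + h) * `|u x - s n.+1 x| <= h * (C * t ^+ n).
  have := ler_wpM2l (ltW h1) d1.
  by rewrite mulrA (_ : (1 + h) * t = h) // /t; field.
have d2' := ler_wpM2l (ltW h0) d2.
apply: le_trans (ler_normB _ _) _; rewrite !normrM (gtr0_norm h1) (gtr0_norm h0).
have := ler_wpM2l (ltW h0) Cn; lra.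
Qed.

(** The supremum [S] of [u] need not be attained, so the hypothesis is used at every point:
    [(a + h) u y <= C + h S]. Taking the supremum over [y] gives [a S <= C]. *)
Lemma maximum_principle a h C u : 0 < a -> 0 <= h -> bnd u ->
  (forall x, a * u x - h * lap K u x <= C) -> forall x, a * u x <= C.
Proof.
move=> a0 h0 bu H x; have [M uM] := bu.
have hu : has_ubound (range u).
  by exists M => _ [y _ <-]; exact: le_trans (ler_norm _) (uM y).
pose S := sup (range u).
have uS y : u y <= S by apply: ub_le_sup => //; exists y.
have ah : 0 < a + h by rewrite ltr_wpDr.
have SC : S <= (C + h * S) / (a + h).
  apply: ge_sup => [|_ [y _ <-]]; first by exists (u x); exists x.
  rewrite ler_pdivlMr //; have := H y; rewrite lapE.
  have := ler_wpM2l h0 (ex_le (K_markov y) bu uS); rewrite -/(mean K u y); lra.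
move: SC; rewrite ler_pdivlMr // => SC.
have := ler_wpM2l (ltW a0) (uS x); lra.
Qed.

Lemma gam_expand h u v x : bnd u -> bnd v ->
  gam K (fun y => u y - h * v y) (fun y => u y - h * v y) x =
  gam K u u x - 2 * h * gam K u v x + h ^+ 2 * gam K v v x.
Proof.
move=> bu bv; rewrite !gamE //; try bd.
have -> : mean K (fun y => u y - h * v y) x = mean K u x - h * mean K v x.
  by rewrite /mean (exB (K_markov x)) ?exZ //; bd.
have -> : mean K (fun y => (u y - h * v y) * (u y - h * v y)) x =
    mean K (fun y => u y * u y) x - 2 * h * mean K (fun y => u y * v y) x
    + h ^+ 2 * mean K (fun y => v y * v y) x.
  rewrite /mean (@eq_ex _ _ _ _ (fun y => u y * u y - (2 * h) * (u y * v y) +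
      h ^+ 2 * (v y * v y))).
    by rewrite (exD (K_markov x)) ?exB ?exZ //; bd.
  by move=> y; ring.
by field.
Qed.

Context {kappa : R}.
Hypothesis kappa_gt0 : 0 < kappa.
Hypothesis K_CDE' : CDE' K kappa.

(** Expand Gamma(u - h L u), drop [h^2] Gamma(L u) and bound [- 2 h] Gamma(u, L u) below by CD. This
    leaves a subsolution inequality for Gamma(u), to which the maximum principle applies. *)
Lemma resolvent_gam h g u C : 0 < h -> bnd u ->
  (forall x, u x - h * lap K u x = g x) ->
  (forall x, gam K g g x <= C) -> forall x, (1 + 2 * kappa * h) * gam K u u x <= C.
Proof.
move=> h0 bu ug gC.
have bgu : bnd (gam K u u) by bd.
have a0 : 0 < 1 + 2 * kappa * h by rewrite ltr_pwDl // !mulr_ge0 // ltW.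
apply: (maximum_principle a0 (ltW h0) bgu) => x; apply: le_trans (gC x).
have -> : g = (fun x => u x - h * lap K u x) by apply/funext.
rewrite gam_expand //; last by bd.
have := gam_ge0 K_markov (lap K u) x => g0.
have := mulr_ge0 (sqr_ge0 h) g0.
have := ler_wpM2l (ltW h0) (CD_real K_markov K_CDE' x bu).
lra.
Qed.

Lemma jump_rate_ge0 x : 0 <= jump_rate K x.
Proof. by rewrite /jump_rate subr_ge0 (prob_le1 (K_markov x)). Qed.

Lemma jump_rate_le x : jump_rate K x <= sup_jump_rate K.
Proof.
apply: ub_le_sup; last by exists x.
exists 1 => _ [y _ <-]; rewrite /jump_rate lerBlDr lerDl.
exact: (prob_ge0 (K_markov y)).
Qed.

(** Since [u] vanishes at [x], Cauchy-Schwarz can be applied against the indicator of [y != x],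
    whose square norm is the jump rate instead of 1. This is where the factor [J] of the final bound
    comes from. *)
Lemma mean_sqr_le u x : bnd u -> u x = 0 ->
  mean K u x ^+ 2 <= jump_rate K x * mean K (fun y => u y ^+ 2) x.
Proof.
move=> bu ux0.
have bx : bnd (fun y => (y == x)%:R : R).
  by apply: (@bnd_itv _ _ 0 1) => y; case: eqP; rewrite ?lexx ?ler01.
have := ex_cauchy_schwarz (K_markov x) bu (v := fun y => 1 - 1 * (y == x)%:R).
have -> : expect (K x) (fun y => (1 - 1 * (y == x)%:R) ^+ 2) = jump_rate K x.
  rewrite (@eq_ex _ _ _ _ (fun y => 1 - 1 * (y == x)%:R)).
    rewrite (exB (K_markov x)) ?ex_cst ?ex_delta ?mul1r //; try bd.
  by move=> y; case: eqP => _ /=; ring.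
rewrite (@eq_ex _ _ _ (fun y => u y * _) u); last first.
  by move=> y; case: eqP => [->|_]; rewrite ?ux0 /=; ring.
rewrite mulrC; apply; bd.
Qed.

Lemma lap_sqr_le u x : bnd u ->
  lap K u x ^+ 2 <= 2 * jump_rate K x * gam K u u x.
Proof.
move=> bu; have -> : lap K u x = mean K (fun y => u y - u x) x.
  by rewrite lapE /mean (exB (K_markov x)) ?ex_cst //; bd.
apply: le_trans (mean_sqr_le _ _) _; [bd|exact: subrr|].
rewrite gam_def (_ : 2 * _ * _ = jump_rate K x * mean K (fun y => (u y - u x) * (u y - u x)) x).
  by rewrite /mean lexx.
by field.
Qed.

(** Each step multiplies the bound on Gamma by [r^2] and moves the function by at most
    [h J c r^(n+1)]. These displacements sum to a geometric series below
    [J c (1 + r) / (2 kappa r)], which tends to [J c / kappa] as [r] tends to 1. *)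
Lemma resolvent_iterates r c g (J := sup_jump_rate K) n :
  0 < r -> r < 1 -> 0 <= c -> bnd g ->
  (forall x, gam K g g x <= J / 2 * c ^+ 2) ->
  exists u, [/\ bnd u, forall x, gam K u u x <= J / 2 * (c * r ^+ n) ^+ 2 &
    forall x, `|u x - g x| <= J * c * ((1 + r) / (2 * kappa * r)) * (1 - r ^+ n)].
Proof.
move=> r0 r1 c0 bg gC.
elim: n => [|n [u [bu uC ug]]].
  exists g; rewrite expr0 mulr1; split => // x.
  by rewrite !subrr normr0 mulr0.
(* the step for which [1 + 2 * kappa * h = r ^- 2] *)
pose h := (1 - r ^+ 2) / (2 * kappa * r ^+ 2).
have r2 : 0 < 1 - r ^+ 2 by rewrite subr_gt0 exprn_ilt1 // ltW.
have h0 : 0 < h by rewrite divr_gt0 // !mulr_gt0 // exprn_gt0.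
have [rn kn] : r != 0 /\ kappa != 0 by rewrite !gt_eqF.
have [v bv vu] := resolvent_exists h0 bu.
have vC x : gam K v v x <= J / 2 * (c * r ^+ n.+1) ^+ 2.
  have := resolvent_gam h0 bv vu uC x.
  have -> : 1 + 2 * kappa * h = (r ^+ 2)^-1 by rewrite /h; field; rewrite rn kn.
  rewrite ler_pdivrMl ?exprn_gt0 // => /le_trans; apply.
  by rewrite (exprS r n) le_eqVlt; apply/orP; left; apply/eqP; ring.
exists v; split => // x.
have J0 : 0 <= J := le_trans (jump_rate_ge0 x) (jump_rate_le x).
have lv : `|lap K v x| <= J * (c * r ^+ n.+1).
  apply: ler_norm_sqr; first by rewrite !mulr_ge0 // exprn_ge0 // ltW.
  apply: le_trans (lap_sqr_le x bv) _.
  have := ler_pM (jump_rate_ge0 x) (gam_ge0 K_markov v x) (jump_rate_le x) (vC x).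
  rewrite -/J => h1; rewrite exprMn.
  have -> : 2 * jump_rate K x * gam K v v x = 2 * (jump_rate K x * gam K v v x).
    by ring.
  apply: le_trans (ler_wpM2l _ h1) _ => //.
  by rewrite le_eqVlt; apply/orP; left; apply/eqP; field.
have vux : `|v x - u x| <= h * (J * (c * r ^+ n.+1)).
  rewrite (_ : v x - u x = h * lap K v x); last by rewrite -(vu x); ring.
  by rewrite normrM gtr0_norm // ler_wpM2l // ltW.
have -> : v x - g x = (v x - u x) + (u x - g x) by ring.
apply: le_trans (ler_normD _ _) _; apply: le_trans (lerD vux (ug x)) _.
rewrite le_eqVlt; apply/orP; left; apply/eqP; rewrite /h (exprS r n); field.
by rewrite rn kn.
Qed.

End resolvent.

(** * Graph distance and diameter *)

Section distance.
Context {R : realType} {X : countType} {K : X -> X -> R}.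
Hypothesis K_markov : markov_kernel K.
Hypothesis K_irreducible : irreducible K.

Lemma kernel_pow_ge0 n x y : (0 <= kernel_pow K n x y)%E.
Proof.
elim: n x => [|n IH] x /=; first by rewrite lee_fin.
by apply: esum_ge0 => z _; rewrite mule_ge0 // lee_fin (prob_ge0 (K_markov x)).
Qed.

Lemma kernel_pow_path n x y : (0 < kernel_pow K n x y)%E ->
  exists2 s, path (fun u v => 0 < K u v) x s & last x s = y.
Proof.
elim: n x => [|n IH] x /=.
  by case: eqP => [-> _|_]; [exists [::]|rewrite ltxx].
move=> H; have [[z [Kz /IH[s ps ls]]]|/forallNP N] :=
  pselect (exists z, 0 < K x z /\ (0 < kernel_pow K n z y)%E).
  by exists (z :: s); rewrite //= Kz.
move: H; rewrite esum1 ?ltxx // => z _.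
have := prob_ge0 (K_markov x) z; rewrite le_eqVlt => /predU1P[<-|Kz].
  by rewrite mul0e.
have := kernel_pow_ge0 n z y; rewrite le_eqVlt => /predU1P[<-|pz].
  by rewrite mule0.
by case: (N z).
Qed.

Lemma path_exists x y :
  exists2 s, path (fun u v => 0 < K u v) x s & last x s = y.
Proof. by have [n] := K_irreducible x y; exact: kernel_pow_path. Qed.

Lemma graph_dist_ge0 x y : (0 <= graph_dist K x y)%E.
Proof. by apply: le_ereal_inf_tmp => _ [s _ <-]; rewrite lee_fin. Qed.

Lemma graph_dist_le x y s : path (fun u v => 0 < K u v) x s -> last x s = y ->
  (graph_dist K x y <= (size s)%:R%:E)%E.
Proof. by move=> ps ls; apply: ereal_inf_lbound; exists s. Qed.

Definition dist x y : R := fine (graph_dist K x y).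

Lemma graph_distE x y : graph_dist K x y = (dist x y)%:E.
Proof.
rewrite /dist fineK // ge0_fin_numE ?graph_dist_ge0 //.
have [s ps ls] := path_exists x y.
exact: le_lt_trans (graph_dist_le ps ls) (ltry _).
Qed.

Lemma dist_ge0 x y : 0 <= dist x y.
Proof. by rewrite -lee_fin -graph_distE graph_dist_ge0. Qed.

Lemma dist_refl x : dist x x = 0.
Proof.
apply/eqP; rewrite eq_le dist_ge0 andbT -lee_fin -graph_distE.
exact: (@graph_dist_le x x [::]).
Qed.

Lemma dist_step x y z : 0 < K y z -> dist x z <= dist x y + 1.
Proof.
move=> Kyz; rewrite -lerBlDr -lee_fin -graph_distE.
apply: le_ereal_inf_tmp => _ [s [ps ls] <-].
rewrite lee_fin lerBlDr -lee_fin -graph_distE natr1 -(size_rcons s z).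
apply: graph_dist_le; last by rewrite last_rcons.
by rewrite rcons_path ps ls.
Qed.

End distance.
Arguments dist {R X} K x y.

Section reversible.
Context {R : realType} {X : countType} {K : X -> X -> R} { pi : X -> R}.
Hypothesis K_markov : markov_kernel K.
Hypothesis K_irreducible : irreducible K.
Hypothesis pi_prob : is_prob pi.
Hypothesis pi_reversible : reversible K pi.
Implicit Types (u v : X -> R).

(** Reversibility carries positivity of [pi] across an edge; irreducibility carries it from one
    point of positive mass to all others. *)
Lemma pi_gt0 x : 0 < pi x.
Proof.
have [x0 p0] := prob_gt0 pi_prob.
have [s ps <-] := path_exists K_markov K_irreducible x0 x.
elim: s x0 p0 ps => [|z s IH] x0 p0 //= /andP[Kz /IH]; apply.
have := mulr_gt0 Kz p0; rewrite pi_reversible => /gt_eqF/negbT.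
rewrite mulf_eq0 negb_or => /andP[_ pz].
by rewrite lt_neqAle eq_sym pz (prob_ge0 pi_prob).
Qed.

Lemma kernel_sym x y : 0 < K x y -> 0 < K y x.
Proof.
move=> Kxy; have := mulr_gt0 Kxy (pi_gt0 x); rewrite pi_reversible.
by rewrite pmulr_lgt0 // pi_gt0.
Qed.

Lemma ex_mean_sym (U : X -> X -> R) : (exists M, forall x y, `|U x y| <= M) ->
  expect pi (fun x => mean K (U x) x) = expect pi (fun x => mean K (fun y => U y x) x).
Proof.
move=> bU; have [M UM] := bU; rewrite /mean.
exact: (ex_exchange pi_prob K_markov pi_prob K_markov pi_reversible bU).
Qed.

Lemma ex_mean u : bnd u -> expect pi (mean K u) = expect pi u.
Proof.
move=> bu; rewrite (@ex_mean_sym (fun=> u)); last by case: bu => M uM; exists M.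
by apply: eq_ex => x; rewrite /mean ex_cst.
Qed.

Lemma ex_lap u : bnd u -> expect pi (lap K u) = 0.
Proof.
move=> bu; rewrite (@eq_ex _ _ _ _ (fun x => mean K u x - u x)).
  by rewrite (exB pi_prob) ?ex_mean ?subrr //; bd.
by move=> x; rewrite lapE.
Qed.

Lemma ex_mul_mean u v : bnd u -> bnd v ->
  expect pi (fun x => u x * mean K v x) = expect pi (fun x => v x * mean K u x).
Proof.
move=> bu bv; have [M uM] := bu; have [N vN] := bv.
have := @ex_mean_sym (fun x y => u x * v y) _.
rewrite (@eq_ex _ _ _ _ (fun x => u x * mean K v x)); last first.
  by move=> x; rewrite /mean (exZ (K_markov x)).
rewrite (@eq_ex _ _ _ (fun x => mean K _ _) (fun x => v x * mean K u x)); last first.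
  move=> x; rewrite /mean -(exZ (K_markov x)) //.
  by apply: eq_ex => y; rewrite mulrC.
by apply; exists (M * N) => x y; rewrite normrM ler_pM.
Qed.

Lemma ex_gam u v : bnd u -> bnd v ->
  expect pi (gam K u v) = - expect pi (fun x => u x * lap K v x).
Proof.
move=> bu bv.
have e1 := ex_mul_mean bv bu.
rewrite (@eq_ex _ _ _ _ (fun x => 2^-1 * (mean K (fun y => u y * v y) x -
   u x * mean K v x - v x * mean K u x + u x * v x))); last by move=> x; exact: gamE.
rewrite [in RHS](@eq_ex _ _ _ _ (fun x => u x * mean K v x - u x * v x)); last first.
  by move=> x; rewrite lapE mulrBr.
rewrite (exZ pi_prob) ?(exD pi_prob) ?(exN pi_prob) ?ex_mean; try bd.
by rewrite e1; field.
Qed.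

(** A bound on Gamma(u) [pi] controls the increment of [u] on each edge of a path from [x] to [y].
    The constant depends on the path and not on [u], so functions with small Gamma are nearly
    constant on finite sets. *)
Lemma connect_gam x y : exists2 C, 0 <= C & forall u e, bnd u -> 0 <= e ->
  (forall z, gam K u u z * pi z <= e ^+ 2) -> `|u x - u y| <= C * e.
Proof.
have [s ps <-] := path_exists K_markov K_irreducible x y.
elim: s x ps => [|z s IH] x /=.
  by exists 0 => // u e _ _ _; rewrite subrr normr0 mul0r.
move=> /andP[Kz /IH[C C0 HC]].
(* This [D] avoids a square root: [2 / (K x z * pi x) = D - 1 <= D^2]. *)
have p0 := pi_gt0 x; pose D := 1 + 2 / (K x z * pi x).
have D1 : 1 <= D by rewrite lerDl divr_ge0 // mulr_ge0 // ltW.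
exists (D + C) => [|u e bu e0 ue]; first by rewrite addr_ge0 // (le_trans _ D1).
have -> : u x - u (last z s) = (u x - u z) + (u z - u (last z s)) by ring.
apply: le_trans (ler_normD _ _) _; rewrite mulrDl lerD //; last exact: HC.
apply: ler_norm_sqr; first by rewrite mulr_ge0 // (le_trans _ D1).
have h : (u z - u x) * (u z - u x) * K x z <= 2 * gam K u u x.
  rewrite gam_def mulrA divff // mul1r.
  apply: (ex_point (K_markov x) z (u := fun y => (u y - u x) * (u y - u x))).
    by bd.
  by move=> w; rewrite -expr2 sqr_ge0.
have h1 := le_trans (ler_wpM2r (ltW p0) h) _.
have {}h1 : (u x - u z) ^+ 2 * (K x z * pi x) <= 2 * e ^+ 2.
  have -> : (u x - u z) ^+ 2 * (K x z * pi x) =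
    (u z - u x) * (u z - u x) * K x z * pi x by ring.
  by apply: h1; have := ue x; lra.
rewrite -ler_pdivlMr ?mulr_gt0 // in h1; apply: le_trans h1 _.
have -> : 2 * e ^+ 2 / (K x z * pi x) = (D - 1) * e ^+ 2 by rewrite /D; ring.
rewrite exprMn ler_wpM2r ?sqr_ge0 // expr2; nra.
Qed.

Context {kappa : R}.
Hypothesis kappa_gt0 : 0 < kappa.
Hypothesis K_CDE' : CDE' K kappa.

(** Only points [y != x] contribute to [gam], and [K x] gives them mass [jump_rate K x]. *)
Lemma lipschitz_gam u x : bnd u ->
  (forall y, 0 < K x y -> `|u y - u x| <= 1) ->
  gam K u u x <= sup_jump_rate K / 2.
Proof.
move=> bu uL.
rewrite gam_def mulrC ler_pM2r ?invr_gt0 //.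
apply: le_trans _ (jump_rate_le K_markov x).
have bx : bnd (fun y => (y == x)%:R : R).
  by apply: (@bnd_itv _ _ 0 1) => y; case: eqP; rewrite ?lexx ?ler01.
have -> : jump_rate K x = expect (K x) (fun y => 1 - 1 * (y == x)%:R).
  by rewrite (exB (K_markov x)) ?ex_cst ?ex_delta ?mul1r //; bd.
apply: (ler_ex_supp (K_markov x)); [bd|bd|] => y Ky.
have := uL y Ky; case: eqP => [->|_] /=; first by rewrite !subrr mul0r mulr1 subrr.
rewrite mulr0 subr0 -expr2 ler_norml => /andP[h1 h2].
by nra.
Qed.

(** Smooth a function worth 0 at [x] and [dist K x y] at [y]. Its Gamma tends to 0, so by
    [connect_gam] the two values merge, while each has moved by at most [J (1 + r) / (2 kappa r)].
    Twice this bounds the distance; then [r] tends to 1. *)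
Lemma diameter x y : dist K x y <= 2 * sup_jump_rate K / kappa.
Proof.
set J := sup_jump_rate K; have J0 : 0 <= J.
  exact: le_trans (jump_rate_ge0 K_markov x) (jump_rate_le K_markov x).
pose B := dist K x y; have B0 : 0 <= B by exact: dist_ge0.
(* The cut at [B] makes the function bounded without changing its value at [y]. *)
pose g z := Num.min (dist K x z) B.
have g0 z : 0 <= g z by rewrite le_min B0 dist_ge0.
have bg : bnd g.
  by apply: (@bnd_itv _ _ 0 B) => z; rewrite g0 ge_min lexx orbT.
have gL z z' : 0 < K z z' -> `|g z' - g z| <= 1.
  move=> Kz; have h1 := dist_step K_markov K_irreducible x Kz.
  have h2 := dist_step K_markov K_irreducible x (kernel_sym Kz).
  rewrite /g ler_norml.
  by case: (leP (dist K x z) B) => ?; case: (leP (dist K x z') B) => ?; apply/andP; split; lra.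
have gG z : gam K g g z <= J / 2 * 1 ^+ 2.
  by rewrite expr1n mulr1; apply: lipschitz_gam => // z' /gL.
have kn : kappa != 0 by rewrite gt_eqF.
have [C C0 HC] := connect_gam x y.
have key r : 0 < r -> r < 1 -> B - J * (1 + r) / (kappa * r) <= 0.
  move=> r0 r1; apply: (@le0_eps _ _ (C * (J + 1))) => e e0.
  have rn : r != 0 by rewrite gt_eqF.
  have [n /ltW rne] := expr_small (ltW r0) r1 e0.
  have [u [bu uG ug]] := resolvent_iterates K_markov kappa_gt0 K_CDE' n r0 r1 ler01 bg gG.
  have q0 : 0 <= r ^+ n by rewrite exprn_ge0 // ltW.
  have q1 : r ^+ n <= 1 by rewrite exprn_ile1 // ltW.
  have uxy : `|u x - u y| <= C * ((J + 1) * r ^+ n).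
    apply: HC => //; first by rewrite mulr_ge0 // addr_ge0.
    move=> z; apply: le_trans (ler_piMr (gam_ge0 K_markov _ _) (prob_le1 pi_prob z)) _.
    apply: le_trans (uG z) _; rewrite mul1r exprMn ler_wpM2r ?sqr_ge0 //.
    by rewrite -/J; have := sqr_ge0 J; lra.
  have gx : g x = 0 by rewrite /g dist_refl // min_l.
  have gy : g y = B by rewrite /g minxx.
  set A := (1 + r) / (2 * kappa * r).
  have A0 : 0 <= J * A.
    by rewrite mulr_ge0 // divr_ge0 ?addr_ge0 ?mulr_ge0 // ltW.
  have ugA z : `|u z - g z| <= J * A.
    apply: le_trans (ug z) _; rewrite mulr1 -/A -/J.
    by rewrite -[leRHS]mulr1 ler_wpM2l // gerBl.
  have := ugA x; have := ugA y; rewrite gx gy !ler_norml.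
  move=> /andP[h1 h2] /andP[h3 h4]; move: uxy; rewrite ler_norml => /andP[h5 h6].
  have -> : J * (1 + r) / (kappa * r) = 2 * (J * A) by rewrite /A; field; rewrite rn kn.
  have h7 : C * ((J + 1) * r ^+ n) <= e * (C * (J + 1)).
    by rewrite mulrA mulrC ler_wpM2r // mulr_ge0 // addr_ge0.
  lra.
rewrite -subr_le0; apply: (@le0_eps _ _ (J / kappa)) => s s0.
have s1 : 0 < 1 + s by rewrite ltr_pwDl // ltW.
have := key (1 + s)^-1; rewrite invr_gt0 invf_lt1 // ltrDl => /(_ s1 s0).
have -> : J * (1 + (1 + s)^-1) / (kappa * (1 + s)^-1) = 2 * J / kappa + s * (J / kappa).
  by field; rewrite kn gt_eqF.
rewrite -/B; lra.
Qed.

End reversible.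

(** * Decay of the energy *)

Section energy.
Context {R : realType} {X : countType} {K : X -> X -> R} { pi : X -> R}.
Hypothesis K_markov : markov_kernel K.
Hypothesis pi_prob : is_prob pi.
Hypothesis pi_reversible : reversible K pi.
Implicit Types (u v : X -> R).

Definition energy (K : X -> X -> R) (pi u : X -> R) : R := expect pi (gam K u u).
Definition pos (a : R) : R := Num.max a 0.

Lemma pos_ge0 a : 0 <= pos a.
Proof. by rewrite le_max lexx orbT. Qed.

Lemma posBpos a : pos a - pos (- a) = a.
Proof.
rewrite /pos; case: (leP a 0) => h; case: (leP (- a) 0) => h'; lra.
Qed.

Lemma energy_ge0 u : 0 <= energy K pi u.
Proof. by apply: ex_ge0 => // x; exact: gam_ge0. Qed.

Lemma ex_half (A B : X -> R) : bnd A -> bnd B -> expect pi A = expect pi B ->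
  expect pi A = expect pi (fun x => 2^-1 * (A x + B x)).
Proof.
move=> bA bB AB; have bAB : bnd (fun x => A x + B x) by bd.
by rewrite (exZ pi_prob) // (exD pi_prob) // -AB; field.
Qed.

(** Exchanging [x] and [y] turns [pos a * b] into [pos (- a) * (- b)], and the two add up to
    [a * b]. So jumps in the direction of growth of [u] alone already carry the whole Dirichlet
    form. *)
Lemma ex_mean_pos (u v : X -> R) : bnd u -> bnd v ->
  expect pi (fun x => mean K (fun y => pos (u y - u x) * (v y - v x)) x) =
  expect pi (gam K u v).
Proof.
move=> bu bv; have [M uM] := bu; have [N vN] := bv.
have B1 x : bnd (fun y => pos (u y - u x) * (v y - v x)) by rewrite /pos; bd.
have B2 x : bnd (fun y => pos (u x - u y) * (v x - v y)) by rewrite /pos; bd.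
have UB : exists C, forall x y, `|pos (u y - u x) * (v y - v x)| <= C.
  exists ((M + M) * (N + N)) => x y; rewrite normrM ler_pM //; last first.
    exact: le_trans (ler_normB _ _) (lerD _ _).
  rewrite ger0_norm ?pos_ge0 // ge_max; have := uM x; have := uM y.
  rewrite !ler_norml => /andP[? ?] /andP[? ?]; apply/andP; split; lra.
have UB' : exists C, forall x y, `|pos (u x - u y) * (v x - v y)| <= C.
  by have [C HC] := UB; exists C.
have BB : bnd (fun x => mean K (fun y => pos (u y - u x) * (v y - v x)) x).
  exact: (bnd_ex K_markov).
have BB' : bnd (fun x => mean K (fun y => pos (u x - u y) * (v x - v y)) x).
  exact: (bnd_ex K_markov).
rewrite (ex_half BB BB' (ex_mean_sym K_markov pi_prob pi_reversible UB)).
apply: eq_ex => x; rewrite gam_def /mean -(exD (K_markov x)) //.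
congr (_ * _); apply: eq_ex => y.
by rewrite -[in RHS](posBpos (u y - u x)) opprB; ring.
Qed.

Lemma energy_pos u : bnd u ->
  expect pi (fun x => mean K (fun y => pos (u y - u x) ^+ 2) x) = energy K pi u.
Proof.
move=> bu; rewrite /energy -ex_mean_pos //; apply: eq_ex => x; apply: eq_ex => y.
by rewrite expr2 /pos; case: leP => h; rewrite ?mul0r // mulr0.
Qed.

(* The convex function [(A - B)^2] of [A^2] and [B^2] lies above its tangent plane
   at [(g x ^ 2, g y ^ 2)]. *)
Lemma tangent_energy (F g : X -> R) d : bnd F -> bnd g -> 0 < d ->
  (forall x, d <= g x) ->
  - expect pi (fun x => lap K g x / g x * F x ^+ 2) <= energy K pi F.
Proof.
move=> bF bg d0 dg; have [M FM] := bF; have [N gN] := bg.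
have g0 x : 0 < g x := lt_le_trans d0 (dg x).
have bV : bnd (fun x => (g x)^-1) by exact: bndV dg.
have [V gV] := bV.
have BT1 x : bnd (fun y => F x ^+ 2 - (F x ^+ 2 / g x) * g y) by bd.
have BT2 x : bnd (fun y => F y ^+ 2 - (F y ^+ 2 / g y) * g x) by bd.
have UB : exists C, forall x y, `|F x ^+ 2 - (F x ^+ 2 / g x) * g y| <= C.
  exists (M ^+ 2 + (M ^+ 2 * V) * N) => x y.
  have h : `|F x ^+ 2| <= M ^+ 2 by rewrite normrX lerXn2r ?nnegrE // (le_trans _ (FM x)).
  apply: le_trans (ler_normB _ _) _; rewrite lerD // normrM ler_pM //.
  by rewrite normrM ler_pM.
have UB' : exists C, forall x y, `|F y ^+ 2 - (F y ^+ 2 / g y) * g x| <= C.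
  by have [C HC] := UB; exists C.
have B1 : bnd (fun x => mean K (fun y => F x ^+ 2 - (F x ^+ 2 / g x) * g y) x).
  exact: (bnd_ex K_markov).
have B2 : bnd (fun x => mean K (fun y => F y ^+ 2 - (F y ^+ 2 / g y) * g x) x).
  exact: (bnd_ex K_markov).
have -> : - expect pi (fun x => lap K g x / g x * F x ^+ 2) =
    expect pi (fun x => mean K (fun y => F x ^+ 2 - (F x ^+ 2 / g x) * g y) x).
  rewrite -(exN pi_prob); last by bd.
  apply: eq_ex => x; rewrite /mean (exB (K_markov x)) ?ex_cst ?exZ //; try bd.
  by rewrite lapE /mean; field; rewrite gt_eqF.
rewrite (ex_half B1 B2 (ex_mean_sym K_markov pi_prob pi_reversible UB)).
have BB := bndM (bnd_cst 2^-1) (bndD B1 B2); have bG := bnd_gam K_markov bF bF.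
apply: (ler_ex pi_prob BB bG) => x.
rewrite gam_def /mean -(exD (K_markov x)) // ler_pM2l ?invr_gt0 //.
have BF : bnd (fun y => (F y - F x) * (F y - F x)) by bd.
apply: (ler_ex (K_markov x) (bndD (BT1 x) (BT2 x)) BF) => y.
rewrite -subr_ge0.
have gn z : g z != 0 by rewrite gt_eqF.
have -> : (F y - F x) * (F y - F x) -
   (F x ^+ 2 - F x ^+ 2 / g x * g y + (F y ^+ 2 - F y ^+ 2 / g y * g x)) =
   (F x * g y - F y * g x) ^+ 2 / (g x * g y).
  by field; rewrite !gn.
by rewrite divr_ge0 ?sqr_ge0 // mulr_ge0 // ltW.
Qed.

Context {kappa : R}.
Hypothesis kappa_gt0 : 0 < kappa.
Hypothesis K_CDE' : CDE' K kappa.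

(** CDE' integrated against [pi]: the Laplacian of Gamma(g) has integral 0, and each remaining
    [gam K g v] becomes [- v * lap K g] by parts. *)
Lemma energy_CDE' (g : X -> R) d : bnd g -> 0 < d -> (forall x, d <= g x) ->
  kappa * energy K pi g <=
  expect pi (fun x => lap K g x ^+ 2 + gam K g g x / g x * lap K g x).
Proof.
move=> bg d0 dg.
have bV : bnd (fun x => (g x)^-1) by exact: bndV dg.
have bl : bnd (lap K g) by bd.
have bG : bnd (gam K g g) by bd.
have bGg : bnd (fun y => gam K g g y / g y) by bd.
rewrite -(exZ pi_prob) //.
apply: le_trans (ler_ex pi_prob _ _ (fun x => CDE'_real K_markov K_CDE' x bg d0 dg)) _.
- by bd.
- by bd.
have -> : expect pi (fun x => 2^-1 * lap K (gam K g g) x - gam K g (lap K g) x -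
      gam K g (fun y => gam K g g y / g y) x) =
    - expect pi (gam K (lap K g) g) - expect pi (gam K (fun y => gam K g g y / g y) g).
  have b1 : bnd (fun x => 2^-1 * lap K (gam K g g) x) by bd.
  have b2 := bnd_gam K_markov bg bl; have b3 := bnd_gam K_markov bg bGg.
  rewrite (exB pi_prob (bndD b1 (bndN b2)) b3) (exB pi_prob b1 b2) (exZ pi_prob).
    rewrite ex_lap // mulr0 sub0r.
    by congr (- _ - _); apply: eq_ex => x; rewrite gamC.
  by bd.
rewrite !ex_gam // !opprK (exD pi_prob); [|bd|bd].
by rewrite lerD2r (@eq_ex _ _ _ _ (fun x => lap K g x ^+ 2)).
Qed.

End energy.

(** * One implicit step: decay of the energy and transport of mass *)

Section implicit_step.
Context {R : realType} {X : countType} {K : X -> X -> R} { pi : X -> R}.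
Hypothesis K_markov : markov_kernel K.
Hypothesis pi_prob : is_prob pi.
Hypothesis pi_reversible : reversible K pi.
Implicit Types (u v : X -> R).

Lemma lap_sqr u x : bnd u ->
  lap K (fun y => u y ^+ 2) x = 2 * (u x * lap K u x) + 2 * gam K u u x.
Proof.
move=> bu; rewrite gamE // !lapE.
rewrite (_ : (fun y => u y * u y) = (fun y => u y ^+ 2)); last first.
  by apply/funext => y; rewrite expr2.
by field.
Qed.

Section decay.
Context {kappa : R}.
Hypothesis kappa_gt0 : 0 < kappa.
Hypothesis K_CDE' : CDE' K kappa.

(** With [g = sqrt G], [f = g^2 - h L(g^2)] and [L(g^2) = 2 g L g + 2] Gamma(g). Put into the
    tangent plane at [g], the part without [h] is the energy of [g], and the part in [h] is [2 h]
    times the integral that [energy_CDE'] bounds below. *)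
Lemma energy_decay (G f : X -> R) d h : bnd G -> 0 < d -> (forall x, d <= G x) ->
  0 <= h -> (forall x, G x - h * lap K G x = f x) -> (forall x, 0 <= f x) ->
  (1 + 2 * kappa * h) * energy K pi (fun x => Num.sqrt (G x)) <=
  energy K pi (fun x => Num.sqrt (f x)).
Proof.
move=> bG d0 dG h0 Gf f0.
have bf : bnd f by rewrite (_ : f = (fun x => G x - h * lap K G x)); [bd|exact/funext].
have [bg bF] := (bnd_sqrt bG, bnd_sqrt bf).
pose g x := Num.sqrt (G x).
have sd : 0 < Num.sqrt d by rewrite sqrtr_gt0.
have dg x : Num.sqrt d <= g x by rewrite ler_wsqrtr.
have gn x : g x != 0 by rewrite gt_eqF // (lt_le_trans sd).
have bV : bnd (fun x => (g x)^-1) by exact: bndV dg.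
have gG : (fun x => g x ^+ 2) = G.
  by apply/funext => x; rewrite sqr_sqrtr // (le_trans (ltW d0)).
apply: le_trans (tangent_energy K_markov pi_prob pi_reversible bF bg sd dg).
have hC := energy_CDE' K_markov pi_prob pi_reversible K_CDE' bg sd dg.
have b1 : bnd (fun x => g x * lap K g x) by bd.
have b2 : bnd (fun x => lap K g x ^+ 2 + gam K g g x / g x * lap K g x) by bd.
have b3 : bnd (fun x => 2 * h * (lap K g x ^+ 2 + gam K g g x / g x * lap K g x)) by bd.
have -> : expect pi (fun x => lap K g x / g x * Num.sqrt (f x) ^+ 2) =
    expect pi (fun x => g x * lap K g x -
      2 * h * (lap K g x ^+ 2 + gam K g g x / g x * lap K g x)).
  apply: eq_ex => x; rewrite sqr_sqrtr // -Gf -gG lap_sqr //.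
  by field; exact: gn.
rewrite (exB pi_prob b1 b3) (exZ pi_prob _ b2).
have -> : expect pi (fun x => g x * lap K g x) = - energy K pi g.
  by rewrite /energy ex_gam // opprK.
have := ler_wpM2l h0 hC; rewrite -/g; lra.
Qed.

End decay.

Context {G f : X -> R} {eps M h : R}.
Hypothesis eps_gt0 : 0 < eps.
Hypothesis h_gt0 : 0 < h.
Hypothesis hM : h * M <= eps.
Hypothesis G_itv : forall x, eps <= G x <= M.
Hypothesis Gf : forall x, G x - h * lap K G x = f x.

Definition jump (h : R) (G : X -> R) y z : R := h * pos (G z - G y) / G y.

(* Mass moves from [G pi] to [f pi] along the edges on which [G] increases;
   [h * M <= eps] makes the total jump probability at most 1. *)
Definition step (K : X -> X -> R) h G y : X -> R :=
  redirect (K y) (jump h G y) y.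

Let G_gt0 x : 0 < G x.
Proof. by have /andP[e _] := G_itv x; exact: lt_le_trans e. Qed.

Let bG : bnd G. Proof. exact: bnd_itv G_itv. Qed.

Let jump_itv y z : 0 <= jump h G y z <= 1.
Proof.
have /andP[l r] := G_itv z; have /andP[l' r'] := G_itv y.
rewrite /jump divr_ge0 ?mulr_ge0 ?pos_ge0 ?(ltW h_gt0) ?(ltW (G_gt0 y)) //=.
rewrite ler_pdivrMr // mul1r; apply: le_trans l'; apply: le_trans hM.
rewrite ler_pM2l // /pos ge_max; have := G_gt0 y; have := G_gt0 z.
by move=> ? ?; apply/andP; split; lra.
Qed.

Let bjump y : bnd (jump h G y). Proof. exact: bnd_itv (jump_itv y). Qed.

Let ex_jump_le1 y : expect (K y) (jump h G y) <= 1.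
Proof. by apply: (ex_le (K_markov y) (bjump y)) => z; case/andP: (jump_itv y z). Qed.

Let jump_ge0 y z : 0 <= jump h G y z.
Proof. by case/andP: (jump_itv y z). Qed.

Lemma step_markov y : is_prob (step K h G y).
Proof. exact: redirect_prob. Qed.

Lemma ex_step y u : bnd u ->
  expect (step K h G y) u = u y + mean K (fun z => jump h G y z * (u z - u y)) y.
Proof.
move=> bu; rewrite ex_redirect //.
have bj := bjump y.
have -> : mean K (fun z => jump h G y z * (u z - u y)) y =
    expect (K y) (fun z => jump h G y z * u z) - u y * expect (K y) (jump h G y).
  rewrite /mean -(exZ (K_markov y) _ bj) -(exB (K_markov y)); [|bd|bd].
  by apply: eq_ex => z; ring.
by ring.
Qed.

Let bnd_mean_pos (w v : X -> R) (bw : bnd w) (bv : bnd v) :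
  bnd (fun y => mean K (fun z => pos (w z - w y) * (v z - v y)) y).
Proof.
have [[A wA] [B vB]] := (bw, bv).
apply: (bnd_ex K_markov); exists ((A + A) * (B + B)) => x y.
rewrite normrM ler_pM //; last exact: le_trans (ler_normB _ _) (lerD _ _).
rewrite ger0_norm ?pos_ge0 // ge_max; have := wA x; have := wA y.
rewrite !ler_norml => /andP[? ?] /andP[? ?]; apply/andP; split; lra.
Qed.

(** The factor [G y] cancels the denominator of [jump]. By [ex_mean_pos] the gain is [h] times the
    integral of [gam K G u], hence [- h] times that of [u * lap K G], and [G - h * lap K G = f]. *)
Lemma step_push u : bnd u ->
  expect pi (fun y => G y * expect (step K h G y) u) = expect pi (fun y => f y * u y).
Proof.
move=> bu; have bm := bnd_mean_pos bG bu.
have E y : G y * expect (step K h G y) u =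
    G y * u y + h * mean K (fun z => pos (G z - G y) * (u z - u y)) y.
  rewrite ex_step // mulrDr; congr (_ + _).
  rewrite /mean -!(exZ (K_markov y)); last 2 first.
  - by rewrite /pos; bd.
  - by have bj := bjump y; bd.
  by apply: eq_ex => z; rewrite /jump; field; rewrite gt_eqF.
rewrite (eq_ex E) (exD pi_prob); [|bd|by apply: bndM; [bd|exact: bm]].
rewrite (exZ pi_prob _ bm) (ex_mean_pos K_markov pi_prob pi_reversible bG bu).
have bl : bnd (fun y => u y * lap K G y) by bd.
rewrite (@eq_ex _ _ _ (fun y => f y * u y) (fun y => G y * u y - h * (u y * lap K G y))).
  rewrite (exB pi_prob) ?(exZ pi_prob _ bl); [|bd|bd].
  have -> : expect pi (gam K G u) = expect pi (gam K u G) by apply: eq_ex => y; rewrite gamC.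
  by rewrite ex_gam //; ring.
by move=> y; rewrite -Gf; ring.
Qed.

Local Notation g := (fun x => Num.sqrt (G x)).

Definition rate1 (K : X -> X -> R) (G : X -> R) y : R :=
  mean K (fun z => pos (Num.sqrt (G z) - Num.sqrt (G y)) ^+ 2) y / G y.

Definition rate2 (K : X -> X -> R) (G : X -> R) y : R :=
  2 * mean K (fun z => pos (Num.sqrt (G z) - Num.sqrt (G y))) y / Num.sqrt (G y).

Let bg : bnd g. Proof. exact: bnd_sqrt. Qed.

Let sqG x : Num.sqrt (G x) ^+ 2 = G x.
Proof. by rewrite sqr_sqrtr // ltW. Qed.

Let g_gt0 x : 0 < Num.sqrt (G x).
Proof. by rewrite sqrtr_gt0. Qed.

Let GV : bnd (fun y => (G y)^-1).
Proof. by apply: (bndV eps_gt0) => x; case/andP: (G_itv x). Qed.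

Let gV : bnd (fun y => (Num.sqrt (G y))^-1).
Proof.
apply: (@bndV _ _ (Num.sqrt eps)) => [|x]; first by rewrite sqrtr_gt0.
by rewrite ler_wsqrtr //; case/andP: (G_itv x).
Qed.

Let bp y : bnd (fun z => pos (Num.sqrt (G z) - Num.sqrt (G y))).
Proof. by rewrite /pos; bd. Qed.

Let bnd_mean_pos2 :
  bnd (fun y => mean K (fun z => pos (Num.sqrt (G z) - Num.sqrt (G y)) ^+ 2) y).
Proof.
have := bnd_mean_pos bg bg; congr bnd; apply/funext => y; apply: eq_ex => z.
by rewrite expr2 /pos; case: leP => ?; rewrite ?mul0r // mulr0.
Qed.

Lemma bnd_rate1 : bnd (rate1 K G).
Proof. exact: bndM. Qed.

Lemma bnd_rate2 : bnd (rate2 K G).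
Proof.
have [A gA] := bg.
apply: bndM gV; apply: bndM; first exact: bnd_cst.
apply: (bnd_ex K_markov); exists (A + A) => x y.
rewrite ger0_norm ?pos_ge0 // ge_max; have := gA x; have := gA y.
rewrite !ler_norml => /andP[? ?] /andP[? ?]; apply/andP; split; lra.
Qed.

Lemma rate1_ge0 y : 0 <= rate1 K G y.
Proof.
rewrite divr_ge0 ?(ltW (G_gt0 y)) //; apply: (ex_ge0 (K_markov y)) => z.
exact: sqr_ge0.
Qed.

Lemma rate2_ge0 y : 0 <= rate2 K G y.
Proof.
rewrite divr_ge0 ?(ltW (g_gt0 y)) // mulr_ge0 //.
by apply: (ex_ge0 (K_markov y)) => z; exact: pos_ge0.
Qed.

Lemma ex_step_le y u : bnd u -> (forall z, 0 < K y z -> u z <= u y + 1) ->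
  expect (step K h G y) u <= u y + h * rate1 K G y + h * rate2 K G y.
Proof.
move=> bu uL; rewrite ex_step // -addrA lerD2l.
have bj := bjump y; have b1 := bp y.
have bq : bnd (fun z => pos (Num.sqrt (G z) - Num.sqrt (G y)) ^+ 2) by apply: bndX.
have E : h * rate1 K G y + h * rate2 K G y = mean K (fun z =>
    h / G y * pos (Num.sqrt (G z) - Num.sqrt (G y)) ^+ 2 +
    2 * h / Num.sqrt (G y) * pos (Num.sqrt (G z) - Num.sqrt (G y))) y.
  rewrite /rate1 /rate2 /mean (exD (K_markov y)); [|by apply: bndM; [bd|]..].
  rewrite (exZ (K_markov y) _ b1) (exZ (K_markov y) _ bq).
  by field; rewrite !gt_eqF.
rewrite E /mean; apply: (ler_ex_supp (K_markov y)).
- by bd.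
- by apply: bndD; apply: bndM => //; exact: bnd_cst.
move=> z Kz; apply: (@le_trans _ _ (jump h G y z)).
  by rewrite ler_piMr //; have := uL z Kz; lra.
(* With [a] and [b] the square roots at [z] and [y], [a^2 - b^2 = (a - b)^2 + 2 b (a - b)], and all
   positive parts vanish together. *)
rewrite le_eqVlt; apply/orP; left; apply/eqP.
have [a0 b0] := (g_gt0 z, g_gt0 y).
set a := Num.sqrt (G z) in a0 *; set b := Num.sqrt (G y) in b0 *.
have bn : b != 0 by rewrite gt_eqF.
rewrite /jump -(sqG z) -(sqG y) -/a -/b /pos.
have E2 : a ^+ 2 - b ^+ 2 = (a - b) * (a + b) by ring.
case: (leP (a - b) 0) => ab.
  have -> : Num.max (a ^+ 2 - b ^+ 2) 0 = 0.
    by apply/max_idPr; rewrite E2 mulr_le0_ge0 // addr_ge0 // ltW.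
  by rewrite expr0n /= !mulr0 mul0r addr0.
have -> : Num.max (a ^+ 2 - b ^+ 2) 0 = a ^+ 2 - b ^+ 2.
  by apply/max_idPl; rewrite E2 mulr_ge0 ?(ltW ab) // addr_ge0 // ltW.
by field.
Qed.

Lemma ex_rate1 : expect pi (fun y => G y * rate1 K G y) = energy K pi g.
Proof.
rewrite -(energy_pos K_markov pi_prob pi_reversible bg); apply: eq_ex => y.
by rewrite /rate1; field; rewrite gt_eqF.
Qed.

(** [G] cancels the squared denominator of [rate2], and the positive part vanishes at [z = y], so
    [mean_sqr_le] brings in the jump rate. *)
Lemma ex_rate2 :
  expect pi (fun y => G y * rate2 K G y ^+ 2) <= 4 * sup_jump_rate K * energy K pi g.
Proof.
rewrite -(energy_pos K_markov pi_prob pi_reversible bg) -(exZ pi_prob) //.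
apply: (ler_ex pi_prob) => [||y].
- by apply: bndM => //; apply: bndX; exact: bnd_rate2.
- by apply: bndM => //; exact: bnd_cst.
have -> : G y * rate2 K G y ^+ 2 =
    4 * mean K (fun z => pos (Num.sqrt (G z) - Num.sqrt (G y))) y ^+ 2.
  by rewrite /rate2 -{1}(sqG y); field; rewrite gt_eqF.
rewrite -mulrA ler_pM2l //; apply: le_trans (mean_sqr_le K_markov (bp y) _) _.
  by rewrite subrr /pos maxxx.
rewrite ler_wpM2r ?jump_rate_le //.
by apply: (ex_ge0 (K_markov y)) => z; exact: sqr_ge0.
Qed.

End implicit_step.

(** * Transport along the iterates *)

(* The terms in [h * k] come from AM-GM on [w * m0] and [w * m1], with the weight
   3/4 that leaves room for the quadratic terms in [cost_recursion]. *)
Lemma cost_increment (R : realFieldType) (m0 m1 D r w h k : R) :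
  0 < k -> 0 < h -> 0 <= m0 <= D -> 0 <= m1 <= D -> 0 <= r -> 0 <= w ->
  m0 <= m1 + h * r + h * w ->
  (1 - 3 * (h * k) / 8) * m0 ^+ 2 <=
  (1 + 3 * (h * k) / 8) * m1 ^+ 2 + 2 * D * h * r + 4 * h / (3 * k) * w ^+ 2.
Proof.
move=> k0 h0 /andP[m00 m0D] /andP[m10 m1D] r0 w0 H.
have k3 : 0 < 3 * k by rewrite mulr_gt0.
have c0 : 0 <= 4 * h / (3 * k) * w ^+ 2.
  by rewrite mulr_ge0 ?sqr_ge0 // divr_ge0 ?mulr_ge0 // ltW.
have hk : 0 <= 3 * (h * k) / 8 by rewrite divr_ge0 // !mulr_ge0 // ltW.
have hm0 : 0 <= 3 * (h * k) / 8 * m0 ^+ 2 by rewrite mulr_ge0 ?sqr_ge0.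
have hm1 : 0 <= 3 * (h * k) / 8 * m1 ^+ 2 by rewrite mulr_ge0 ?sqr_ge0.
have [le|/ltW le] := leP m0 m1.
  have : m0 ^+ 2 <= m1 ^+ 2 by rewrite lerXn2r.
  have : 0 <= 2 * D * h * r by rewrite !mulr_ge0 ?(ltW h0) // (le_trans m00).
  lra.
have amgm m : w * m <= 3 * k / 8 * m ^+ 2 + 2 / (3 * k) * w ^+ 2.
  rewrite -subr_ge0.
  have -> : 3 * k / 8 * m ^+ 2 + 2 / (3 * k) * w ^+ 2 - w * m =
     (3 * k * m / 4 - w) ^+ 2 * (2 / (3 * k)) by field; rewrite gt_eqF.
  by rewrite mulr_ge0 ?sqr_ge0 // divr_ge0 // ltW.
have h1 : m0 ^+ 2 - m1 ^+ 2 <= (h * r + h * w) * (m0 + m1).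
  rewrite subr_sqr ler_wpM2r ?addr_ge0 //; lra.
have h2 : h * r * (m0 + m1) <= h * r * (2 * D).
  by rewrite ler_wpM2l ?mulr_ge0 ?(ltW h0) //; lra.
have h3 := ler_wpM2l (ltW h0) (lerD (amgm m0) (amgm m1)).
have e : h * (3 * k / 8 * m0 ^+ 2 + 2 / (3 * k) * w ^+ 2 +
    (3 * k / 8 * m1 ^+ 2 + 2 / (3 * k) * w ^+ 2)) =
    3 * (h * k) / 8 * m0 ^+ 2 + 3 * (h * k) / 8 * m1 ^+ 2 + 4 * h / (3 * k) * w ^+ 2.
  by field; rewrite gt_eqF.
rewrite e in h3.
have e1 : (1 - 3 * (h * k) / 8) * m0 ^+ 2 = m0 ^+ 2 - 3 * (h * k) / 8 * m0 ^+ 2 by ring.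
have e2 : (1 + 3 * (h * k) / 8) * m1 ^+ 2 = m1 ^+ 2 + 3 * (h * k) / 8 * m1 ^+ 2 by ring.
rewrite e1 e2; move: h1 h2 h3 c0; set q := 4 * h / _ * _; lra.
Qed.

(** With [s = h kappa] and [a = 4 J E1 / kappa^2], the right-hand side of the recursion is at most
    [2 a + 37/12 s a], and [1 - 3 s / 8] times the target is at least [2 a + 13/4 s a - 3/2 s^2 a].
    The gap [s a / 6] covers the quadratic term when [s <= 1/9], whence the restriction on the
    step. *)
Lemma cost_recursion (R : realFieldType) (kappa h J E0 E1 z0 z1 : R) :
  0 < kappa -> 0 < h -> h * kappa <= 9^-1 -> 0 <= J -> 0 <= E1 ->
  (1 + 2 * kappa * h) * E1 <= E0 -> z1 <= 8 * J / kappa ^+ 2 * E1 ->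
  (1 - 3 * (h * kappa) / 8) * z0 <= (1 + 3 * (h * kappa) / 8) * z1 +
    2 * (2 * J / kappa) * h * E1 + 4 * h / (3 * kappa) * (4 * J * E1) ->
  z0 <= 8 * J / kappa ^+ 2 * E0.
Proof.
move=> kappa_gt0 h0 hk J0 E10 decay Gc main.
have kn : kappa != 0 by rewrite gt_eqF.
pose a := 4 * J / kappa ^+ 2 * E1; pose s := h * kappa.
have s0 : 0 < s by rewrite mulr_gt0.
have a0 : 0 <= a.
  by rewrite mulr_ge0 // divr_ge0 ?sqr_ge0 // mulr_ge0 // J0.
have i1 : 2 * (2 * J / kappa) * h * E1 = s * a by rewrite /a /s; field.
have i2 : 4 * h / (3 * kappa) * (4 * J * E1) = 4 / 3 * (s * a).
  by rewrite /a /s; field.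
have i3 : z1 <= 2 * a by rewrite /a; apply: le_trans Gc _; lra.
have i4 : 2 * a * (1 + 2 * s) <= 8 * J / kappa ^+ 2 * E0.
  have -> : 2 * a * (1 + 2 * s) = 8 * J / kappa ^+ 2 * ((1 + 2 * kappa * h) * E1).
    by rewrite /a /s; ring.
  by rewrite ler_wpM2l // divr_ge0 ?sqr_ge0 // mulr_ge0 // J0.
rewrite i1 i2 -/s in main; rewrite -/s in hk.
apply: le_trans i4.
have t0 : 0 < 1 - 3 * s / 8 by lra.
rewrite -(ler_pM2l t0); apply: le_trans main _.
have i5 := ler_wpM2l (_ : 0 <= 1 + 3 * s / 8) i3.
have i6 : 0 <= s * a by rewrite mulr_ge0 // ltW.
have i7 : s * (s * a) <= 9^-1 * (s * a) by rewrite ler_wpM2r.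
have i8 : 0 <= 1 + 3 * s / 8 by lra.
have := i5 i8.
have -> : (1 - 3 * s / 8) * (2 * a * (1 + 2 * s)) =
   2 * a + 13 / 4 * (s * a) - 3 / 2 * (s * (s * a)) by field.
have -> : (1 + 3 * s / 8) * (2 * a) = 2 * a + 3 / 4 * (s * a) by field.
have -> : (1 + 3 * s / 8) * z1 = z1 + 3 * s / 8 * z1 by ring.
lra.
Qed.

Section chain.
Context {R : realType} {X : countType} {K : X -> X -> R} { pi : X -> R} {kappa : R}.
Hypothesis K_markov : markov_kernel K.
Hypothesis K_irreducible : irreducible K.
Hypothesis pi_prob : is_prob pi.
Hypothesis pi_reversible : reversible K pi.
Hypothesis kappa_gt0 : 0 < kappa.
Hypothesis K_CDE' : CDE' K kappa.
Implicit Types (u v f G : X -> R) (p : X -> X -> R).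

Local Notation J := (sup_jump_rate K).
Local Notation D := (2 * J / kappa).

Lemma dist_itv x y : 0 <= dist K x y <= D.
Proof.
rewrite dist_ge0 //=.
exact: (diameter K_markov K_irreducible pi_prob pi_reversible kappa_gt0 K_CDE').
Qed.

Lemma bnd_dist x : bnd (dist K x).
Proof. exact: bnd_itv (dist_itv x). Qed.

(** The kernel [p] carries [G pi] to [f pi]. Tested on bounded functions, this composes by applying
    it to another test function. *)
Definition pushes p G f : Prop :=
  forall u, bnd u -> expect pi (fun x => G x * expect (p x) u) = expect pi (fun x => f x * u x).

Definition mean_dist p x : R := expect (p x) (dist K x).

Lemma mean_dist_itv p x : is_prob (p x) -> 0 <= mean_dist p x <= D.
Proof. by move=> px; apply: (ex_itv px); exact: dist_itv. Qed.

Lemma bnd_mean_dist p : (forall x, is_prob (p x)) -> bnd (mean_dist p).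
Proof. by move=> Hp; apply: bnd_itv => x; exact: mean_dist_itv. Qed.

Lemma resolvent_itv h f G a b : 0 < h -> bnd G ->
  (forall x, G x - h * lap K G x = f x) ->
  (forall x, a <= f x <= b) -> forall x, a <= G x <= b.
Proof.
move=> h0 bG Gf fab x; apply/andP; split; last first.
  rewrite -[G x]mul1r; apply: (maximum_principle K_markov ltr01 (ltW h0) bG) => y.
  by rewrite mul1r Gf; case/andP: (fab y).
rewrite -lerN2 -[- G x]mul1r.
(* The opposite of [G], in the shape that [lap_affine] expects. *)
have bN : bnd (fun y => 0 + -1 * G y) by bd.
have -> : - G x = 0 + -1 * G x by ring.
apply: (maximum_principle K_markov ltr01 (ltW h0) bN) => y.
rewrite lap_affine // mul1r; have := Gf y; have /andP[] := fab y; lra.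
Qed.

(** Induction on [n] for all [f]: the hypothesis for the resolvent [f1] gives a kernel from [G pi]
    to [f1 pi], and the jump from [f1 pi] to [f pi] is appended last. The bounds [eps] and [M] pass
    to [f1], so one step size serves all iterates. *)
Lemma chain eps M h n f : 0 < eps -> 0 < h -> h * M <= eps -> h * kappa <= 9^-1 ->
  (forall x, eps <= f x <= M) ->
  exists G p, [/\ forall x, eps <= G x <= M, forall x, is_prob (p x),
    (1 + 2 * kappa * h) ^+ n * energy K pi (fun x => Num.sqrt (G x)) <=
      energy K pi (fun x => Num.sqrt (f x)),
    pushes p G f &
    expect pi (fun x => G x * mean_dist p x ^+ 2) <=
      8 * J / kappa ^+ 2 * energy K pi (fun x => Num.sqrt (f x))].
Proof.
move=> eps0 h0 hM hk.
have kn : kappa != 0 by rewrite gt_eqF.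
have J0 (x : X) : 0 <= J := le_trans (jump_rate_ge0 K_markov x) (jump_rate_le K_markov x).
have [x0 _] := prob_gt0 pi_prob.
elim: n f => [|n IH] f fM.
  have Hp x : is_prob (redirect (K x) (fun=> 0) x).
    by apply: redirect_prob => //; [exact: bnd_cst|rewrite ex_cst].
  have Ep x u : bnd u -> expect (redirect (K x) (fun=> 0) x) u = u x.
    move=> bu; rewrite ex_redirect //; last exact: bnd_cst.
    rewrite (@eq_ex _ _ _ _ (fun=> 0)) ?ex_cst //; first by ring.
    by move=> z; rewrite mul0r.
  exists f, (fun x => redirect (K x) (fun=> 0) x); split => //.
  - by rewrite expr0 mul1r.
  - by move=> u bu; apply: eq_ex => x; rewrite Ep.
  - rewrite (@eq_ex _ _ _ _ (fun=> 0)) ?ex_cst //.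
      rewrite mulr_ge0 ?energy_ge0 // divr_ge0 ?sqr_ge0 // mulr_ge0 //.
      exact: J0 x0.
    by move=> x; rewrite /mean_dist Ep ?dist_refl ?expr0n ?mulr0 //; exact: bnd_dist.
have bf : bnd f := bnd_itv fM.
have [f1 bf1 f1f] := resolvent_exists K_markov h0 bf.
have f1M := resolvent_itv h0 bf1 f1f fM.
have f0 x : 0 <= f x by case/andP: (fM x) => /(le_trans (ltW eps0)).
have e1 x : eps <= f1 x by case/andP: (f1M x).
have decay := energy_decay K_markov pi_prob pi_reversible K_CDE' bf1 eps0 e1 (ltW h0) f1f f0.
have [G [p [GM Hp GE Gp Gc]]] := IH f1 f1M.
have HS y : is_prob (step K h f1 y) by exact: (step_markov K_markov eps0 h0 hM f1M).
pose p' x := compw (p x) (step K h f1).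
have Hp' x : is_prob (p' x) by exact: compw_prob.
have Ep' x u : bnd u -> expect (p' x) u = expect (p x) (fun y => expect (step K h f1 y) u).
  by move=> bu; rewrite ex_compw.
have bG : bnd G := bnd_itv GM.
exists G, p'; split; [exact: GM|exact: Hp'|..].
- rewrite exprS -mulrA; apply: le_trans decay; apply: ler_wpM2l GE.
  by rewrite addr_ge0 // !mulr_ge0 // ltW.
- move=> u bu; rewrite (eq_ex (fun x => congr1 (fun t => G x * t) (Ep' x u bu))).
  have bs : bnd (fun y => expect (step K h f1 y) u) by exact: bnd_ex1.
  rewrite (Gp _ bs).
  exact: (step_push K_markov pi_prob pi_reversible eps0 h0 hM f1M f1f bu).
set E1 := energy K pi (fun x => Num.sqrt (f1 x)) in decay Gc.
set E0 := energy K pi (fun x => Num.sqrt (f x)) in decay *.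
have br1 := bnd_rate1 K_markov eps0 f1M; have br2 := bnd_rate2 K_markov eps0 f1M.
have bq2 := bndX 2 br2.
have bm1 := bnd_mean_dist Hp; have bm0 := bnd_mean_dist Hp'.
have b1 : bnd (fun x => expect (p x) (rate1 K f1)) by exact: bnd_ex1.
have b2 : bnd (fun x => expect (p x) (fun y => rate2 K f1 y ^+ 2)) by exact: bnd_ex1.
have G0 x : 0 <= G x by case/andP: (GM x) => /(le_trans (ltW eps0)).
have pt x : G x * ((1 - 3 * (h * kappa) / 8) * mean_dist p' x ^+ 2) <=
    G x * ((1 + 3 * (h * kappa) / 8) * mean_dist p x ^+ 2 +
    2 * D * h * expect (p x) (rate1 K f1) +
    4 * h / (3 * kappa) * expect (p x) (fun y => rate2 K f1 y ^+ 2)).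
  rewrite ler_wpM2l //.
  have r10 : 0 <= expect (p x) (rate1 K f1).
    by apply: ex_ge0 => // y; exact: (rate1_ge0 K_markov eps0 f1M).
  have r20 : 0 <= expect (p x) (rate2 K f1).
    by apply: ex_ge0 => // y; exact: (rate2_ge0 K_markov eps0 f1M).
  (* [cost_increment] yields the square of the mean of [rate2]; Jensen's inequality moves the square
     inside, where [ex_rate2] can act. *)
  apply: le_trans (cost_increment kappa_gt0 h0 (mean_dist_itv (Hp' x))
    (mean_dist_itv (Hp x)) r10 r20 _) _; last first.
    rewrite lerD2l ler_wpM2l ?ex_sqr //.
    by rewrite divr_ge0 ?mulr_ge0 // ltW.
  rewrite /mean_dist Ep'; last exact: bnd_dist.
  have bd0 := bnd_dist x.
  have c1 := bndM (bnd_cst h) br1; have c2 := bndM (bnd_cst h) br2.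
  rewrite -(exZ (Hp x) h br1) -(exZ (Hp x) h br2).
  rewrite -(exD (Hp x) bd0 c1) -(exD (Hp x) (bndD bd0 c1) c2).
  apply: (ler_ex (Hp x)); [exact: bnd_ex1|exact: bndD (bndD bd0 c1) c2|] => y.
  apply: (ex_step_le K_markov eps0 h0 hM f1M bd0) => z Kz.
  exact: dist_step.
(* Pushing forward by [p] turns averages over [G pi] into integrals against [f1 pi], the measure for
   which the rates are controlled. *)
have Gr1 : expect pi (fun x => G x * expect (p x) (rate1 K f1)) = E1.
  by rewrite (Gp _ br1) (ex_rate1 K_markov pi_prob pi_reversible eps0 f1M).
have Gr2 : expect pi (fun x => G x * expect (p x) (fun y => rate2 K f1 y ^+ 2)) <= 4 * J * E1.
  by rewrite (Gp _ bq2); exact: (ex_rate2 K_markov pi_prob pi_reversible eps0 f1M).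
have c1 : bnd (fun x => G x * mean_dist p x ^+ 2) by bd.
have c0 : bnd (fun x => G x * mean_dist p' x ^+ 2) by bd.
have c3 : bnd (fun x => G x * expect (p x) (rate1 K f1)) by apply: bndM.
have c4 : bnd (fun x => G x * expect (p x) (fun y => rate2 K f1 y ^+ 2)) by apply: bndM.
set z1 := expect pi (fun x => G x * mean_dist p x ^+ 2) in Gc.
set z0 := expect pi (fun x => G x * mean_dist p' x ^+ 2).
have main : (1 - 3 * (h * kappa) / 8) * z0 <= (1 + 3 * (h * kappa) / 8) * z1 +
    2 * D * h * E1 + 4 * h / (3 * kappa) * (4 * J * E1).
  apply: (@le_trans _ _ ((1 + 3 * (h * kappa) / 8) * z1 + 2 * D * h * E1 +
    4 * h / (3 * kappa) * expect pi (fun x => G x * expect (p x) (fun y => rate2 K f1 y ^+ 2)))).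
    rewrite -Gr1 /z1 /z0 -(exZ pi_prob _ c0) -(exZ pi_prob _ c1) -(exZ pi_prob _ c3)
      -(exZ pi_prob _ c4).
    have d1 := bndM (bnd_cst (1 + 3 * (h * kappa) / 8)) c1.
    have d3 := bndM (bnd_cst (2 * D * h)) c3.
    have d4 := bndM (bnd_cst (4 * h / (3 * kappa))) c4.
    rewrite -(exD pi_prob d1 d3) -(exD pi_prob (bndD d1 d3) d4).
    apply: (ler_ex pi_prob (bndM (bnd_cst _) c0) (bndD (bndD d1 d3) d4)) => x.
    rewrite mulrCA; apply: le_trans (pt x) _.
    by rewrite le_eqVlt; apply/orP; left; apply/eqP; ring.
  rewrite lerD2l; apply: ler_wpM2l Gr2; rewrite divr_ge0 ?mulr_ge0 //; exact: ltW.
have E10 : 0 <= E1 by exact: energy_ge0.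
exact: (cost_recursion kappa_gt0 h0 hk (J0 x0) E10 decay Gc main).
Qed.

End chain.
Arguments mean_dist {R X} K p x.
Arguments pushes {R X} pi p G f.

(** * Approximation *)

Section finite_mass.
Context {R : realType} {X : countType}.

Definition seq_ind (s : seq X) (x : X) : R := (x \in s)%:R.

Lemma seq_ind_itv s x : 0 <= seq_ind s x <= 1.
Proof. by rewrite /seq_ind; case: (x \in s); rewrite ?lexx ?ler01. Qed.

Lemma bnd_seq_ind s : bnd (seq_ind s).
Proof. exact: bnd_itv (seq_ind_itv s). Qed.

Lemma finite_mass (w : X -> R) e : is_prob w -> 0 < e ->
  exists s : seq X, 1 - e <= expect w (seq_ind s).
Proof.
move=> Hw e0.
have : ((1 - e)%:E < \esum_(x in setT) (w x)%:E)%E.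
  by rewrite Hw.2 lte_fin gtrBl.
move=> /ereal_sup_gt[_ [A [fA _] <-] lt].
have /finite_seqP[s As] := fA; exists s.
have i0 x : 0 <= seq_ind s x by case/andP: (seq_ind_itv s x).
rewrite -lee_fin -(ex_esum Hw (bnd_seq_ind s) i0); apply: le_trans (ltW lt) _.
apply: esum_ge; exists A; first by split.
rewrite le_eqVlt; apply/orP; left; apply/eqP; apply: eq_fsbigr => x.
by rewrite As inE /= /seq_ind => ->; rewrite mul1r.
Qed.

Lemma seq_sum_ge (C : X -> R) s x : (forall x, 0 <= C x) -> x \in s ->
  C x <= \sum_(y <- s) C y.
Proof.
move=> C0; elim: s => //= y s IH; rewrite inE big_cons => /predU1P[->|/IH h].
  by rewrite lerDl sumr_ge0.
by rewrite (le_trans h) // lerDr.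
Qed.

End finite_mass.

Section near_one.
Context {R : realType} {X : countType} {K : X -> X -> R} { pi : X -> R}.
Hypothesis K_markov : markov_kernel K.
Hypothesis K_irreducible : irreducible K.
Hypothesis pi_prob : is_prob pi.
Hypothesis pi_reversible : reversible K pi.

(** On a finite set of mass at least [1 - eta / (4 M)], small energy keeps [G] within [eta / 4] of
    [G x0]; outside, the error is at most [M]. So [G] is within [eta / 2] of [G x0] in mean, and
    total mass 1 puts [G x0] within [eta / 2] of 1. *)
Lemma energy_near_one eps M eta : 0 < eps -> 0 < M -> 0 < eta ->
  exists2 d, 0 < d & forall G : X -> R, (forall x, eps <= G x <= M) ->
    expect pi G = 1 -> energy K pi (fun x => Num.sqrt (G x)) <= d ->
    1 - eta <= expect pi (fun x => Num.min 1 (G x)).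
Proof.
move=> eps0 M0 eta0.
have e10 : 0 < eta / (4 * M) by rewrite divr_gt0 // mulr_gt0.
have [s sP] := finite_mass pi_prob e10.
have [x0 _] := prob_gt0 pi_prob.
have H x : exists C, 0 <= C /\ forall u e, bnd u -> 0 <= e ->
    (forall z, gam K u u z * pi z <= e ^+ 2) -> `|u x - u x0| <= C * e.
  have [C C0 HC] := connect_gam K_markov K_irreducible pi_prob pi_reversible x x0.
  by exists C.
have [C CP] := choice H.
have C0 x : 0 <= C x by case: (CP x).
pose S := \sum_(x <- s) C x + 1.
have S0 : 0 < S by rewrite ltr_wpDl // sumr_ge0.
pose r := Num.sqrt M; have r0 : 0 < r by rewrite sqrtr_gt0.
have k0 : 0 < 2 * r * S * 4 by rewrite !mulr_gt0.
(* Chosen to give [rho = eta / 4]: on [s] the increments of [g] are at most [S * e], and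
   [g x + g x0 <= 2 r]. *)
pose e := eta / (2 * r * S * 4); have e0 : 0 < e by rewrite divr_gt0.
exists (e ^+ 2) => [|G GM G1 GE]; first by rewrite exprn_gt0.
have bG := bnd_itv GM; pose g x := Num.sqrt (G x); have bg : bnd g := bnd_sqrt bG.
have g0 x : 0 <= g x by exact: sqrtr_ge0.
have gr x : g x <= r by rewrite ler_wsqrtr //; case/andP: (GM x).
have gG x : g x ^+ 2 = G x.
  by rewrite sqr_sqrtr //; case/andP: (GM x) => /(le_trans (ltW eps0)).
pose rho := 2 * r * (S * e).
have rhoE : rho = eta / 4 by rewrite /rho /e; field; rewrite !gt_eqF.
have dG x : `|G x - G x0| <= rho + M * (1 - seq_ind s x).
  have /andP[i0 i1] := seq_ind_itv (R := R) s x.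
  have [xs|xs] := boolP (x \in s); last first.
    have -> : seq_ind s x = 0 :> R by rewrite /seq_ind (negbTE xs).
    have /andP[? ?] := GM x; have /andP[? ?] := GM x0.
    have : 0 <= rho by rewrite rhoE divr_ge0 // ltW.
    by rewrite ler_norml => ?; apply/andP; split; lra.
  have -> : seq_ind s x = 1 :> R by rewrite /seq_ind xs.
  rewrite subrr mulr0 addr0 -!gG subr_sqr normrM mulrC ler_pM //.
    have -> : 2 * r = r + r by ring.
    by rewrite ger0_norm ?addr_ge0 // lerD.
  have [_ HC] := CP x; apply: le_trans (HC g e bg (ltW e0) _) _; last first.
    rewrite ler_wpM2r ?(ltW e0) //.
    by have := seq_sum_ge C0 xs; rewrite /S; lra.
  move=> z; apply: le_trans GE; apply: (ex_point pi_prob z (u := gam K g g)).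
    by bd.
  exact: gam_ge0.
have bI := bnd_seq_ind (R := R) s.
have bB : bnd (fun x => rho + M * (1 - seq_ind s x)) by bd.
have EB : expect pi (fun x => rho + M * (1 - seq_ind s x)) <= eta / 2.
  rewrite (exD pi_prob) ?ex_cst ?exZ ?(exB pi_prob) ?ex_cst //; try bd.
  have := ler_wpM2l (ltW M0) sP.
  have -> : M * (1 - eta / (4 * M)) = M - eta / 4 by field; rewrite gt_eqF.
  by rewrite rhoE; lra.
have bd0 : bnd (fun x => G x - G x0) by bd.
have h1 : `|1 - G x0| <= eta / 2.
  have <- : expect pi (fun x => G x - G x0) = 1 - G x0.
    by rewrite (exB pi_prob bG (bnd_cst _)) ex_cst // G1.
  apply: le_trans EB; rewrite ler_norml -(exN pi_prob bB); apply/andP; split.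
    apply: (ler_ex pi_prob (bndN bB) bd0) => x.
    by have := dG x; rewrite ler_norml => /andP[].
  apply: (ler_ex pi_prob bd0 bB) => x.
  by have := dG x; rewrite ler_norml => /andP[].
have bm : bnd (fun x => Num.min 1 (G x)).
  apply: (@bnd_itv _ _ 0 1) => x; have /andP[l _] := GM x.
  by rewrite le_min ge_min lexx ler01 (le_trans (ltW eps0) l).
have pt x : G x - (rho + M * (1 - seq_ind s x)) - eta / 2 <= Num.min 1 (G x).
  have := dG x; have := h1; rewrite !ler_norml => /andP[a b] /andP[c d].
  have : 0 <= rho + M * (1 - seq_ind s x) by exact: le_trans (normr_ge0 _) (dG x).
  by rewrite le_min => ?; apply/andP; split; lra.
have := ler_ex pi_prob (bndD (bndD bG (bndN bB)) (bnd_cst (- (eta / 2)))) bm pt.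
rewrite (exB pi_prob (bndD bG (bndN bB)) (bnd_cst _)) (exB pi_prob bG bB) ex_cst // G1.
lra.
Qed.

End near_one.

(** * Repairing a marginal by redrawing mass *)

Section resample.
Context {R : realType} {X : countType} { pi f0 alpha nu : X -> R} {c : R}.
Hypothesis pi_prob : is_prob pi.
Hypothesis nu_prob : is_prob nu.
Hypothesis f0_bnd : bnd f0.
Hypothesis f0_mass : expect pi f0 = 1.
Hypothesis alpha_itv : forall x, 0 <= alpha x <= 1.
Hypothesis c_gt0 : 0 < c.
Hypothesis removed_mass : expect pi (fun x => f0 x * (1 - alpha x)) = c.
Hypothesis kept_le : forall x, f0 x * alpha x * pi x <= nu x.

(* At [x], stay put with probability [alpha x], and otherwise draw a new point
   from the part of [nu] that [f0 * alpha * pi] does not cover. *)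
Definition excess z : R := (nu z - f0 z * alpha z * pi z) / c.

Definition resample x : X -> R := redirect excess (fun=> 1 - alpha x) x.

Let ba : bnd alpha. Proof. exact: bnd_itv alpha_itv. Qed.

Let bfa : bnd (fun x => f0 x * alpha x). Proof. exact: bndM. Qed.

Let excess_sm u : bnd u ->
  summ (fun z => u z * excess z) /\
  c * sm (fun z => u z * excess z) = expect nu u - expect pi (fun x => f0 x * alpha x * u x).
Proof.
move=> bu; have s1 := summ_ex nu_prob bu.
have bfu : bnd (fun x => f0 x * alpha x * u x) by exact: bndM.
have s2 := summ_ex pi_prob bfu.
have s3 := summD s1 (summN s2).
have E : (fun z => u z * excess z) =
    (fun z => c^-1 * (u z * nu z + - (f0 z * alpha z * u z * pi z))).
  by apply/funext => z; rewrite /excess; field; rewrite gt_eqF.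
rewrite E; split; first exact: summZ.
rewrite smZ // mulrA divff ?gt_eqF // mul1r smD // ?smN //; exact: summN.
Qed.

Let mass_kept : expect pi (fun x => f0 x * alpha x) = 1 - c.
Proof.
rewrite -removed_mass.
rewrite (@eq_ex _ _ _ (fun x => f0 x * (1 - _)) (fun x => f0 x - f0 x * alpha x)).
  by rewrite (exB pi_prob) // f0_mass; ring.
by move=> x; ring.
Qed.

(** The kept part has mass [1 - c], so what [nu] has beyond it has mass [c], the normalising
    constant. *)
Lemma excess_prob : is_prob excess.
Proof.
have e0 x : 0 <= excess x by rewrite divr_ge0 ?(ltW c_gt0) // subr_ge0.
split => //; have [s E] := excess_sm (bnd_cst 1).
have E1 : (fun z => 1 * excess z) = excess by apply/funext => z; rewrite mul1r.
rewrite E1 in s E; rewrite esum_smE //; congr EFin.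
have cn : c != 0 by rewrite gt_eqF.
apply: (mulfI cn); rewrite E ex_cst // (@eq_ex _ _ _ _ (fun x => f0 x * alpha x)).
  by rewrite mass_kept; ring.
by move=> x; rewrite mulr1.
Qed.

Lemma ex_excess u : bnd u ->
  c * expect excess u = expect nu u - expect pi (fun x => f0 x * alpha x * u x).
Proof. by move=> bu; case: (excess_sm bu). Qed.

Let lost_itv x : 0 <= 1 - alpha x <= 1.
Proof. by have /andP[? ?] := alpha_itv x; apply/andP; split; lra. Qed.

Let ex_lost x : expect excess (fun=> 1 - alpha x) = 1 - alpha x.
Proof. exact: (ex_cst excess_prob). Qed.

Lemma resample_markov x : is_prob (resample x).
Proof.
apply: redirect_prob; first exact: excess_prob.
- exact: bnd_cst.
- by move=> _; case/andP: (lost_itv x).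
- by rewrite ex_lost; case/andP: (lost_itv x).
Qed.

Lemma ex_resample x u : bnd u ->
  expect (resample x) u = (1 - alpha x) * expect excess u + alpha x * u x.
Proof.
move=> bu; rewrite ex_redirect //; [|exact: excess_prob|exact: bnd_cst].
by rewrite ex_lost (exZ excess_prob) //; ring.
Qed.

Lemma resample_push u : bnd u -> expect pi (fun x => f0 x * expect (resample x) u) = expect nu u.
Proof.
move=> bu; have b1 : bnd (fun x => f0 x * (1 - alpha x)) by bd.
have b2 : bnd (fun x => f0 x * alpha x * u x) by exact: bndM.
rewrite (@eq_ex _ _ _ _ (fun x => expect excess u * (f0 x * (1 - alpha x)) + f0 x * alpha x * u x)).
  rewrite (exD pi_prob (bndM (bnd_cst _) b1) b2) (exZ pi_prob _ b1) removed_mass.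
  by rewrite mulrC ex_excess //; ring.
by move=> x; rewrite ex_resample //; ring.
Qed.

End resample.
Arguments excess {R X} pi f0 alpha nu c z.
Arguments resample {R X} pi f0 alpha nu c x _.

(** For [a <= M], with [A = t a + c] and [d = sqrt b - sqrt a], one has [t b + c = A + 2 t sqrt a d
    + t d^2 <= (sqrt A + d)^2] because [t sqrt a <= sqrt A]. Hence the regularised density has no
    more Fisher information than [f]. *)
Lemma sqrt_contraction (R : rcfType) (t c M a b : R) :
  0 <= t <= 1 -> 0 <= c -> 0 <= M -> 0 <= a -> 0 <= b ->
  (Num.sqrt (t * Num.min a M + c) - Num.sqrt (t * Num.min b M + c)) ^+ 2 <=
  (Num.sqrt a - Num.sqrt b) ^+ 2.
Proof.
move=> /andP[t0 t1] c0 M0; wlog ab : a b / a <= b => [H|a0 b0].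
  have [/H//|/ltW/H h] := leP a b; move=> a0 b0.
  by rewrite -sqrrN opprB -(sqrrN (Num.sqrt a - _)) opprB; exact: h.
set A := t * Num.min a M + c; set B := t * Num.min b M + c.
have ma0 : 0 <= Num.min a M by rewrite le_min a0.
have mb0 : 0 <= Num.min b M by rewrite le_min b0.
have A0 : 0 <= A by rewrite addr_ge0 // mulr_ge0.
have B0 : 0 <= B by rewrite addr_ge0 // mulr_ge0.
have [sa sb] := (sqr_sqrtr a0, sqr_sqrtr b0).
have [sA sB] := (sqr_sqrtr A0, sqr_sqrtr B0).
have AB : A <= B.
  rewrite lerD2r ler_wpM2l // le_min ge_min ab /= ge_min lexx orbT //.
have hAB := ler_wsqrtr AB; have hab := ler_wsqrtr ab.
suff h : Num.sqrt B <= Num.sqrt A + (Num.sqrt b - Num.sqrt a).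
  rewrite -sqrrN opprB -(sqrrN (Num.sqrt a - _)) opprB.
  by rewrite lerXn2r ?nnegrE ?subr_ge0 //; lra.
have pA := sqrtr_ge0 A; have pa := sqrtr_ge0 a.
rewrite -ler_sqr ?nnegrE ?sqrtr_ge0 //; last by rewrite addr_ge0 // subr_ge0.
rewrite sqrrD sA sB.
have d0 : 0 <= Num.sqrt b - Num.sqrt a by rewrite subr_ge0.
have [Ma|aM] := leP M a.
  have -> : B = A by rewrite /A /B !min_r // (le_trans Ma).
  by rewrite -addrA lerDl addr_ge0 ?sqr_ge0 // mulrn_wge0 // mulr_ge0.
have Ea : A = t * a + c by rewrite /A min_l // ltW.
have tA : t * Num.sqrt a <= Num.sqrt A.
  rewrite -ler_sqr ?nnegrE ?mulr_ge0 // exprMn sa sA Ea.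
  have : t ^+ 2 * a <= t * a by rewrite ler_wpM2r // expr2 ler_piMl.
  lra.
have hB : B <= t * b + c by rewrite lerD2r ler_wpM2l // ge_min lexx.
have eb : b = a + 2 * Num.sqrt a * (Num.sqrt b - Num.sqrt a) +
    (Num.sqrt b - Num.sqrt a) ^+ 2.
  by rewrite -{1}sb -{1}sa; ring.
move: d0 eb; set d := Num.sqrt b - Num.sqrt a => d0 eb.
have h1 : t * b = t * a + 2 * (t * Num.sqrt a * d) + t * d ^+ 2 by rewrite {1}eb; ring.
have h2 : t * Num.sqrt a * d <= Num.sqrt A * d by rewrite ler_wpM2r.
have h3 : t * d ^+ 2 <= d ^+ 2 by rewrite ler_piMl ?sqr_ge0.
have -> : Num.sqrt A * d *+ 2 = 2 * (Num.sqrt A * d) by rewrite mulr2n; ring.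
move: h2 h3; set u := t * Num.sqrt a * d in h1 *; set v := Num.sqrt A * d; set w := d ^+ 2 in h1 *.
rewrite h1 in hB; rewrite Ea; lra.
Qed.

(** * Comparison of energy and Fisher information *)

Section fisher.
Context {R : realType} {X : countType} {K : X -> X -> R} { pi : X -> R}.
Hypothesis K_markov : markov_kernel K.
Hypothesis pi_prob : is_prob pi.

Lemma ssum_ge0 (a : X -> \bar R) : (forall x, 0 <= a x)%E ->
  ssum a = (\esum_(x in setT) a x)%E.
Proof.
move=> a0; rewrite /ssum [X in (_ - X)%E]esum1 ?sube0.
  by apply: eq_esum => x _; rewrite funeposE; apply/max_idPl.
by move=> x _; rewrite funenegE; apply/max_idPr; rewrite leeNl oppe0.
Qed.

(** Here [v] may be unbounded with infinite Gamma, so the sums are compared term by term in the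
    extended reals. *)
Lemma Gamma_le (u v : X -> R) x : bnd u ->
  (forall y, (u y - u x) ^+ 2 <= (v y - v x) ^+ 2) ->
  ((gam K u u x)%:E <= Gamma K (EFin \o v) x)%E.
Proof.
move=> bu uv; rewrite gam_def EFinM /Gamma /cdc lee_pmul2l //.
have Kx := prob_ge0 (K_markov x).
rewrite ssum_ge0; last first.
  by move=> y; rewrite /= lee_fin mulr_ge0 // -expr2 sqr_ge0.
rewrite -(ex_esum (K_markov x)); last 2 first.
- by bd.
- by move=> y; rewrite -expr2 sqr_ge0.
by apply: le_esum => y _; rewrite /= lee_fin ler_wpM2r // -!expr2.
Qed.

Lemma fisher_ge (u f : X -> R) : bnd u ->
  (forall x y, (u y - u x) ^+ 2 <= (Num.sqrt (f y) - Num.sqrt (f x)) ^+ 2) ->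
  ((4 * energy K pi u)%:E <= fisher_info K pi f)%E.
Proof.
move=> bu uf; rewrite EFinM /fisher_info lee_pmul2l // /energy.
rewrite -(ex_esum pi_prob); [|by bd|exact: gam_ge0].
apply: le_esum => x _; rewrite EFinM lee_wpmul2r ?lee_fin ?(prob_ge0 pi_prob) //.
exact: Gamma_le.
Qed.

Lemma fisher_ge0 (f : X -> R) : (0 <= fisher_info K pi f)%E.
Proof.
have := @fisher_ge (fun=> 0) f (bnd_cst _) _.
rewrite subrr expr0n => /(_ (fun x y => sqr_ge0 _)); apply: le_trans.
by rewrite lee_fin mulr_ge0 //; apply: energy_ge0.
Qed.

End fisher.

Section transport.
Context {R : realType} {X : countType} {K : X -> X -> R} { pi : X -> R} {kappa : R}.
Hypothesis K_markov : markov_kernel K.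
Hypothesis K_irreducible : irreducible K.
Hypothesis pi_prob : is_prob pi.
Hypothesis pi_reversible : reversible K pi.
Hypothesis kappa_gt0 : 0 < kappa.
Hypothesis K_CDE' : CDE' K kappa.

Local Notation J := (sup_jump_rate K).
Local Notation D := (2 * J / kappa).

Let dist_D x y : 0 <= dist K x y <= D.
Proof. exact: (dist_itv K_markov K_irreducible pi_prob pi_reversible kappa_gt0 K_CDE'). Qed.

Let bdist x : bnd (dist K x).
Proof. exact: bnd_itv (dist_D x). Qed.

Lemma weak_W2_sq_le (nu : X -> R) (p : X -> X -> R) :
  is_prob nu -> (forall x, is_prob (p x)) ->
  (forall u, bnd u -> expect pi (fun x => expect (p x) u) = expect nu u) ->
  (weak_W2_sq K nu pi <= (expect pi (fun x => mean_dist K p x ^+ 2))%:E)%E.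
Proof.
move=> Hnu Hp push; apply: ereal_inf_lbound.
have p0 x y : 0 <= p x y by exact: prob_ge0 (Hp x) y.
have pi0 x : 0 <= pi x by exact: prob_ge0.
exists (fun x y => p x y * pi x), p; split.
- split => [x y|x|y]; first by rewrite mulr_ge0.
    have -> : (pi x)%:E = ((pi x)%:E * \esum_(y in setT) (p x y)%:E)%E.
      by rewrite (Hp x).2 mule1.
    rewrite -esumZl // => [|y]; last by rewrite lee_fin.
    by apply: eq_esum => y _; rewrite EFinM muleC.
  (* Testing the push-forward on the indicator of [y] gives the second marginal at [y]. *)
  have bI : bnd (fun z => 1 * (z == y)%:R : R).
    by apply: (@bnd_itv _ _ 0 1) => z; rewrite mul1r; case: eqP; rewrite ?lexx ?ler01.
  have b1 : bnd (fun x => p x y).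
    by apply: (@bnd_itv _ _ 0 1) => x; rewrite p0 (prob_le1 (Hp x)).
  rewrite (ex_esum pi_prob b1) //; congr EFin.
  have := push _ bI; rewrite ex_delta mul1r => <-.
  by apply: eq_ex => x; rewrite ex_delta mul1r.
- by split.
- have bm : bnd (fun x => mean_dist K p x ^+ 2).
    apply: bndX; apply: bnd_ex => //; exists D => x y.
    by rewrite ger0_norm; case/andP: (dist_D x y).
  rewrite -(ex_esum pi_prob bm); last by move=> x; exact: sqr_ge0.
  apply: eq_esum => x _; rewrite EFinM EFin_expe; congr (_ ^+ 2 * _)%E.
  rewrite /mean_dist -(ex_esum (Hp x)) //; last by move=> y; case/andP: (dist_D x y).
  by apply: eq_esum => y _; rewrite graph_distE // EFinM.
Qed.

Lemma sup_jump_rate_le1 (x0 : X) : J <= 1.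
Proof.
apply: ge_sup; first by exists (jump_rate K x0); exists x0.
by move=> _ [x _ <-]; rewrite /jump_rate lerBlDr lerDl (prob_ge0 (K_markov x)).
Qed.

(** [M] is chosen to dominate [f] on a finite set carrying all but [e] of the mass of [f pi]. *)
Lemma truncation (f : X -> R) e : 0 < e -> e <= 1 -> (forall x, 0 <= f x) ->
  is_prob (fun x => f x * pi x) ->
  exists2 M, 0 < M & 1 - e <= expect pi (fun x => Num.min (f x) M) <= 1.
Proof.
move=> e0 e1 f0 Hf; have [s sP] := finite_mass Hf e0.
have pi0 x : 0 <= pi x by exact: prob_ge0.
pose M := \sum_(x <- s) f x + 1.
have M0 : 0 < M by rewrite ltr_wpDl // sumr_ge0.
have m0 x : 0 <= Num.min (f x) M by rewrite le_min f0 ltW.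
have bm : bnd (fun x => Num.min (f x) M).
  by apply: (@bnd_itv _ _ 0 M) => x; rewrite m0 ge_min lexx orbT.
have i0 x : 0 <= seq_ind (R := R) s x by case/andP: (seq_ind_itv (R := R) s x).
exists M => //; apply/andP; split; rewrite -lee_fin.
  apply: le_trans (_ : (expect (fun x => f x * pi x) (seq_ind s))%:E <= _)%E.
    by rewrite lee_fin.
  rewrite -(ex_esum Hf (bnd_seq_ind s) i0) -(ex_esum pi_prob bm m0).
  apply: le_esum => x _; rewrite lee_fin mulrA ler_wpM2r //.
  rewrite /seq_ind; have [xs|] := boolP (x \in s); last by rewrite mul0r.
  by rewrite mul1r le_min lexx /=; have := seq_sum_ge f0 xs; rewrite /M; lra.
rewrite -(ex_esum pi_prob bm m0) -[leRHS]Hf.2.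
by apply: le_esum => x _; rewrite lee_fin ler_wpM2r // ge_min lexx.
Qed.

End transport.

(** Here [a] is the probability of staying at the first redraw and [q] the mean probability of
    moving at the last. With [b = (1 - a) + a q <= 1] the hypothesis reads [mt <= a m + D b]; in the
    square, the cross term and [(D b)^2] add up to at most [3 D^2 b]. *)
Lemma cost_resample (R : realFieldType) (D a g m q mt : R) :
  0 <= a <= 1 -> a <= g -> 0 <= m <= D -> 0 <= q <= 1 -> 0 <= mt ->
  mt <= D * (1 - a) + a * (D * q + m) ->
  mt ^+ 2 <= g * m ^+ 2 + 4 * D ^+ 2 * ((1 - a) + g * q).
Proof.
move=> /andP[a0 a1] ag /andP[m0 mD] /andP[q0 q1] mt0 H.
have D0 : 0 <= D := le_trans m0 mD.
set b := (1 - a) + a * q.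
have aq : a * q <= a by rewrite ler_piMr.
have aq0 : 0 <= a * q by rewrite mulr_ge0.
have b0 : 0 <= b by rewrite /b; lra.
have b1 : b <= 1 by rewrite /b; lra.
have am : a * m <= D by apply: le_trans mD; rewrite ler_piMl.
have am0 : 0 <= a * m by rewrite mulr_ge0.
have E : D * (1 - a) + a * (D * q + m) = a * m + D * b by rewrite /b; ring.
rewrite E in H.
have Db0 : 0 <= D * b by rewrite mulr_ge0.
have h1 : mt ^+ 2 <= (a * m + D * b) ^+ 2 by rewrite lerXn2r ?nnegrE ?addr_ge0.
apply: le_trans h1 _.
have h2 : (a * m) ^+ 2 <= g * m ^+ 2.
  rewrite exprMn ler_wpM2r ?sqr_ge0 //; apply: le_trans ag.
  by rewrite expr2 ler_piMl.
have h3 : a * m * (D * b) <= D * (D * b) by rewrite ler_wpM2r.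
have h4 : (D * b) * (D * b) <= D * (D * b) by rewrite ler_wpM2r // ler_piMr.
have h5 : D ^+ 2 * b <= D ^+ 2 * ((1 - a) + g * q).
  by rewrite ler_wpM2l ?sqr_ge0 // /b lerD2l ler_wpM2r.
have h6 : D * (D * b) = D ^+ 2 * b by ring.
have h7 : 0 <= D ^+ 2 * b by rewrite mulr_ge0 ?sqr_ge0.
have -> : (a * m + D * b) ^+ 2 = (a * m) ^+ 2 + 2 * (a * m * (D * b)) + D * b * (D * b).
  by ring.
rewrite h6 in h3 h4.
have -> : 4 * D ^+ 2 * ((1 - a) + g * q) = 4 * (D ^+ 2 * ((1 - a) + g * q)) by ring.
lra.
Qed.

(** * Assembling the transport plan *)

Section main.
Context {R : realType} {X : countType} {K : X -> X -> R} { pi : X -> R} {kappa : R}.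
Hypothesis K_markov : markov_kernel K.
Hypothesis K_irreducible : irreducible K.
Hypothesis pi_prob : is_prob pi.
Hypothesis pi_reversible : reversible K pi.
Hypothesis kappa_gt0 : 0 < kappa.
Hypothesis K_CDE' : CDE' K kappa.

Local Notation J := (sup_jump_rate K).
Local Notation D := (2 * J / kappa).

Let pi0 x : 0 <= pi x. Proof. exact: prob_ge0. Qed.

Let D_itv x y : 0 <= dist K x y <= D.
Proof. exact: (dist_itv K_markov K_irreducible pi_prob pi_reversible kappa_gt0 K_CDE'). Qed.

Let bdist x : bnd (dist K x).
Proof. exact: bnd_itv (D_itv x). Qed.

(** A plan in three stages: a redraw of mass [c0] turns [pi] into [G pi], [p] leads on to [fb pi],
    and a redraw of mass [c1] ends at [nu]. Redrawn mass travels at most the diameter. *)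
Lemma weak_W2_sq_resample (G fb a0 a1 nu : X -> R) (c0 c1 : R) (p : X -> X -> R) :
  bnd G -> (forall x, 0 <= G x) -> expect pi G = 1 ->
  (forall x, is_prob (p x)) -> pushes pi p G fb -> bnd fb -> expect pi fb = 1 ->
  (forall x, 0 <= a0 x <= 1) -> (forall x, a0 x <= G x) ->
  0 < c0 -> expect pi a0 = 1 - c0 ->
  is_prob nu -> (forall x, 0 <= a1 x <= 1) -> 0 < c1 ->
  (forall x, fb x * (1 - a1 x) = c1) -> (forall x, fb x * a1 x * pi x <= nu x) ->
  (weak_W2_sq K nu pi <=
   (expect pi (fun x => G x * mean_dist K p x ^+ 2) + 4 * D ^+ 2 * (c0 + c1))%:E)%E.
Proof.
move=> bG G0 G1 Hp Gp bfb fb1 a0I a0G c00 a0c Hnu a1I c10 fbc kept1.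
have ba0 := bnd_itv a0I; have ba1 := bnd_itv a1I.
pose nu0 x := G x * pi x.
have Hnu0 : is_prob nu0.
  split => [x|]; first by rewrite mulr_ge0.
  by rewrite (ex_esum pi_prob) // G1.
have exnu0 u : expect nu0 u = expect pi (fun x => G x * u x).
  by rewrite /expect /nu0; congr sm; apply/funext => x; ring.
have removed0 : expect pi (fun x => 1 * (1 - a0 x)) = c0.
  rewrite (@eq_ex _ _ _ _ (fun x => 1 - a0 x)) => [|x]; last by rewrite mul1r.
  by rewrite (exB pi_prob (bnd_cst 1) ba0) ex_cst // a0c; ring.
have removed1 : expect pi (fun x => fb x * (1 - a1 x)) = c1.
  by rewrite (eq_ex fbc) ex_cst.
have kept0 x : 1 * a0 x * pi x <= nu0 x by rewrite mul1r ler_wpM2r.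
have mass1 : expect pi (fun=> 1) = 1 by rewrite ex_cst.
pose r0 := resample pi (fun=> 1) a0 nu0 c0; pose r1 := resample pi fb a1 nu c1.
have Hr0 x : is_prob (r0 x).
  exact: (resample_markov pi_prob Hnu0 (bnd_cst 1) mass1 a0I c00 removed0 kept0).
have Hr1 x : is_prob (r1 x).
  exact: (resample_markov pi_prob Hnu bfb fb1 a1I c10 removed1 kept1).
pose pr1 y := compw (p y) r1; have Hpr1 y : is_prob (pr1 y) by exact: compw_prob.
pose pt x := compw (r0 x) pr1; have Hpt x : is_prob (pt x) by exact: compw_prob.
have Epr1 y u : bnd u -> expect (pr1 y) u = expect (p y) (fun z => expect (r1 z) u).
  by move=> bu; rewrite ex_compw.
have Ept x u : bnd u -> expect (pt x) u = expect (r0 x) (fun y => expect (pr1 y) u).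
  by move=> bu; rewrite ex_compw.
apply: le_trans (weak_W2_sq_le K_markov K_irreducible pi_prob pi_reversible
  kappa_gt0 K_CDE' Hnu Hpt _) _.
  move=> u bu.
  have b1 : bnd (fun z => expect (r1 z) u) by exact: bnd_ex1.
  have b2 : bnd (fun y => expect (pr1 y) u) by exact: bnd_ex1.
  have := resample_push pi_prob Hnu0 (bnd_cst 1) mass1 a0I c00 removed0 kept0 b2.
  rewrite (@eq_ex _ _ _ (fun x => 1 * _) (fun x => expect (pt x) u)) => [->|x]; last first.
    by rewrite mul1r Ept.
  rewrite exnu0 (@eq_ex _ _ _ _ (fun x => G x * expect (p x) (fun z => expect (r1 z) u))).
    rewrite (Gp _ b1).
    exact: (resample_push pi_prob Hnu bfb fb1 a1I c10 removed1 kept1 bu).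
  by move=> x; rewrite Epr1.
have bl1 : bnd (fun z => 1 - a1 z) by bd.
pose q y := expect (p y) (fun z => 1 - a1 z).
have bq : bnd q by exact: bnd_ex1.
have l1I z : 0 <= 1 - a1 z <= 1.
  by have /andP[? ?] := a1I z; apply/andP; split; lra.
have qI y : 0 <= q y <= 1 by exact: (ex_itv (Hp y)).
have meanI p' : (forall x, is_prob (p' x)) -> forall x, 0 <= mean_dist K p' x <= D.
  by move=> Hp' x; apply: (ex_itv (Hp' x)).
have mI := meanI p Hp; have mtI := meanI pt Hpt.
have bm := bnd_itv mI; have bmt := bnd_itv mtI.
have Gq : expect pi (fun x => G x * q x) = c1 by rewrite (Gp _ bl1).
have exr1 z x : expect (r1 z) (dist K x) <= D * (1 - a1 z) + dist K x z.
  have Hex := excess_prob pi_prob Hnu bfb fb1 a1I c10 removed1 kept1.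
  rewrite (ex_resample pi_prob Hnu bfb fb1 a1I c10 removed1 kept1) //.
  have /andP[_ h] := ex_itv Hex (D_itv x).
  have /andP[a10 a11] := a1I z; have /andP[d0 d1] := D_itv x z.
  apply: lerD; last by rewrite ler_piMl.
  by rewrite mulrC ler_wpM2r // subr_ge0.
have expr1 y x : expect (pr1 y) (dist K x) <= D * q y + expect (p y) (dist K x).
  have bd1 := bndM (bnd_cst D) bl1.
  rewrite Epr1 // /q -(exZ (Hp y) _ bl1) -(exD (Hp y) bd1 (bdist x)).
  by apply: (ler_ex (Hp y)) => //; [exact: bnd_ex1|exact: bndD].
have mt_le x : mean_dist K pt x <=
    D * (1 - a0 x) + a0 x * (D * q x + mean_dist K p x).
  have b2 : bnd (fun y => expect (pr1 y) (dist K x)) by exact: bnd_ex1.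
  have Hex := excess_prob pi_prob Hnu0 (bnd_cst 1) mass1 a0I c00 removed0 kept0.
  rewrite /mean_dist Ept // (ex_resample pi_prob Hnu0 (bnd_cst 1) mass1 a0I c00 removed0 kept0) //.
  have /andP[a00 a01] := a0I x.
  apply: lerD; last by rewrite ler_wpM2l.
  rewrite mulrC ler_wpM2r ?subr_ge0 //; apply: (ex_le Hex b2) => y.
  by have /andP[] := ex_itv (Hpr1 y) (D_itv x).
have b1 : bnd (fun x => G x * mean_dist K p x ^+ 2) by apply: bndM => //; exact: bndX.
have b2 : bnd (fun x => 1 - a0 x) by bd.
have b3 : bnd (fun x => G x * q x) by exact: bndM.
have b23 := bndD b2 b3.
have b4 := bndM (bnd_cst (4 * D ^+ 2)) b23.
have -> : c0 + c1 = expect pi (fun x => (1 - a0 x) + G x * q x).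
  by rewrite (exD pi_prob b2 b3) Gq (exB pi_prob (bnd_cst 1) ba0) ex_cst // a0c; ring.
rewrite -(exZ pi_prob _ b23) -(exD pi_prob b1 b4) lee_fin.
apply: (ler_ex pi_prob (bndX 2 bmt) (bndD b1 b4)) => x.
apply: (cost_resample (a0I x) (a0G x) (mI x) (qI x) _ (mt_le x)).
by case/andP: (mtI x).
Qed.

Lemma weak_W2_sq_approx (f : X -> R) e : 0 < e -> e <= 2^-1 ->
  (forall x, 0 <= f x) -> is_prob (fun x => f x * pi x) ->
  (weak_W2_sq K (fun x => f x * pi x)%R pi <=
   (2 * J / kappa ^+ 2)%:E * fisher_info K pi f + (4 * D ^+ 2 * (4 * e))%:E)%E.
Proof.
move=> e0 e2 f0 Hf; have e1 : e <= 1 by lra.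
have [M M0 /andP[m1 m2]] := truncation pi_prob e0 e1 f0 Hf.
(* The factor [t < 1] makes both redrawn masses [c] and [c'] at least [e], even if truncation
   removes nothing: [excess] divides by them, and [c] bounds [fb] from below. *)
pose t := 1 - e; have t0 : 0 <= t by rewrite /t; lra.
have t1 : t <= 1 by rewrite /t; lra.
have tI : 0 <= t <= 1 by rewrite t0 t1.
pose fM x := Num.min (f x) M.
have fMI x : 0 <= fM x <= M by rewrite /fM le_min f0 (ltW M0) ge_min lexx orbT.
have bfM := bnd_itv fMI.
pose c := 1 - t * expect pi fM.
have mass_bounds m : 1 - e <= m <= 1 -> e <= 1 - t * m <= 2 * e.
  move=> /andP[h1 h2].
  have h3 : t * m <= 1 - e by rewrite -/t ler_piMr.
  have h4 : t * (1 - e) <= t * m by rewrite ler_wpM2l.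
  have h5 : t * (1 - e) = 1 - 2 * e + e ^+ 2 by rewrite /t; ring.
  rewrite h5 in h4; have h6 := sqr_ge0 e; apply/andP; split; lra.
have /andP[ec c2] : e <= c <= 2 * e by apply: mass_bounds; rewrite m1 m2.
have c0 : 0 < c := lt_le_trans e0 ec.
pose fb x := t * fM x + c; pose M' := M + 1.
have fbI x : e <= fb x <= M'.
  have /andP[h1 h2] := fMI x.
  have h3 : 0 <= t * fM x by rewrite mulr_ge0.
  have h4 : t * fM x <= fM x by rewrite ler_piMl.
  by rewrite /fb /M'; apply/andP; split; lra.
have fb0 x : 0 < fb x by have /andP[h _] := fbI x; exact: lt_le_trans h.
have bfb := bnd_itv fbI.
have fb1 : expect pi fb = 1.
  rewrite /fb (exD pi_prob (bndM (bnd_cst t) bfM) (bnd_cst c)) (exZ pi_prob _ bfM).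
  by rewrite ex_cst // /c; ring.
pose E := energy K pi (fun x => Num.sqrt (fb x)).
have E0 : 0 <= E by exact: energy_ge0.
have EF : ((4 * E)%:E <= fisher_info K pi f)%E.
  apply: (fisher_ge K_markov pi_prob (bnd_sqrt bfb)) => x y.
  by apply: sqrt_contraction => //; exact: ltW.
have M'0 : 0 < M' by rewrite addr_gt0.
have [d d0 Hd] := energy_near_one K_markov K_irreducible pi_prob pi_reversible e0 M'0 e0.
(* The first bound keeps jump probabilities at most 1; the second is the condition of
   [cost_recursion]. *)
pose h := Num.min (e / M') (9 * kappa)^-1.
have h0 : 0 < h by rewrite lt_min divr_gt0 // invr_gt0 mulr_gt0.
have hM : h * M' <= e by rewrite -ler_pdivlMr // ge_min lexx.
have hk : h * kappa <= 9^-1.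
  by rewrite -ler_pdivlMr // -invfM ge_min lexx orbT.
have k1 : 1 < 1 + 2 * kappa * h by rewrite ltrDl !mulr_gt0.
pose s := (1 + 2 * kappa * h)^-1.
have k0 : 0 < 1 + 2 * kappa * h := lt_trans ltr01 k1.
have s0 : 0 <= s by rewrite invr_ge0 ltW.
have s1 : s < 1 by rewrite invf_lt1.
(* This will give [E * s ^+ n <= d]; the denominator [E + 1] covers [E = 0]. *)
have dE : 0 < d / (E + 1) by rewrite divr_gt0 // ltr_wpDl.
have [n sn] := expr_small s0 s1 dE.
have [G [p [GI Hp GE Gp Gc]]] := chain K_markov K_irreducible pi_prob pi_reversible
  kappa_gt0 K_CDE' n e0 h0 hM hk fbI.
have bG := bnd_itv GI.
have G0 x : 0 <= G x by case/andP: (GI x) => /(le_trans (ltW e0)).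
have G1 : expect pi G = 1.
  have := Gp _ (bnd_cst 1).
  rewrite (@eq_ex _ _ _ _ G) => [->|x]; last by rewrite ex_cst ?mulr1.
  by rewrite (@eq_ex _ _ _ _ fb) // => x; rewrite mulr1.
have Gd : energy K pi (fun x => Num.sqrt (G x)) <= d.
  have : energy K pi (fun x => Num.sqrt (G x)) <= E * s ^+ n.
    by rewrite /s exprVn ler_pdivlMr ?exprn_gt0 // mulrC.
  move/le_trans; apply; apply: le_trans (ler_wpM2l E0 (ltW sn)) _.
  by rewrite mulrA ler_pdivrMr ?ltr_wpDl // mulrC ler_wpM2l ?(ltW d0) // lerDl.
have g1 := Hd G GI G1 Gd.
have mI x : 0 <= Num.min 1 (G x) <= 1 by rewrite le_min ler01 G0 ge_min lexx.
have bm := bnd_itv mI.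
have g2 : expect pi (fun x => Num.min 1 (G x)) <= 1 by case/andP: (ex_itv pi_prob mI).
pose c' := 1 - t * expect pi (fun x => Num.min 1 (G x)).
have /andP[ec' c'2] : e <= c' <= 2 * e by apply: mass_bounds; rewrite g1 g2.
have c'0 : 0 < c' := lt_le_trans e0 ec'.
(* [a0] keeps, up to [t], the mass common to [pi] and [G pi]; [a1] is the share of [fb] that comes
   from [f], the rest being the constant [c]. *)
pose a0 x := t * Num.min 1 (G x); pose a1 x := t * fM x / fb x.
have a0I x : 0 <= a0 x <= 1.
  by have /andP[? ?] := mI x; rewrite /a0 mulr_ge0 //= mulr_ile1.
have a0G x : a0 x <= G x.
  have /andP[h1 h2] := mI x; apply: (@le_trans _ _ (Num.min 1 (G x))).
    by rewrite /a0 ler_piMl.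
  by rewrite ge_min lexx orbT.
have a0c : expect pi a0 = 1 - c' by rewrite /a0 (exZ pi_prob _ bm) /c'; ring.
have a1I x : 0 <= a1 x <= 1.
  have /andP[h1 h2] := fMI x.
  rewrite /a1 divr_ge0 ?mulr_ge0 ?(ltW (fb0 x)) //= ler_pdivrMr // mul1r.
  by rewrite /fb lerDl ltW.
have fba x : fb x * a1 x = t * fM x by rewrite /a1 mulrCA divff ?mulr1 ?gt_eqF.
have fbc x : fb x * (1 - a1 x) = c by rewrite mulrBr fba /fb; ring.
have kept x : fb x * a1 x * pi x <= f x * pi x.
  rewrite fba ler_wpM2r //; have /andP[h1 h2] := fMI x.
  apply: (@le_trans _ _ (fM x)); first by rewrite ler_piMl.
  by rewrite /fM ge_min lexx.
apply: le_trans (weak_W2_sq_resample bG G0 G1 Hp Gp bfb fb1 a0I a0G c'0 a0c Hf a1I c0 fbc kept) _.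
rewrite EFinD; apply: leeD.
  apply: (@le_trans _ _ ((2 * J / kappa ^+ 2)%:E * (4 * E)%:E)%E).
    rewrite -EFinM lee_fin; apply: le_trans Gc _.
    by rewrite le_eqVlt; apply/orP; left; apply/eqP; rewrite /E; ring.
  apply: lee_wpmul2l EF; rewrite lee_fin divr_ge0 ?sqr_ge0 // mulr_ge0 //.
  have [x0 _] := prob_gt0 pi_prob.
  exact: le_trans (jump_rate_ge0 K_markov x0) (jump_rate_le K_markov x0).
rewrite lee_fin; apply: ler_wpM2l; first by rewrite mulr_ge0 ?sqr_ge0.
by rewrite (_ : 4 * e = 2 * e + 2 * e); [exact: lerD|ring].
Qed.

End main.

Theorem theorem1p12 (R : realType) (X : countType) (K : X -> X -> R)
  (pi : X -> R) (kappa : R)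
  (K_markov : markov_kernel K) (K_irreducible : irreducible K)
  (pi_prob : is_prob pi) (pi_reversible : reversible K pi)
  (kappa_gt0 : 0 < kappa) (K_CDE' : CDE' K kappa)
  (f : X -> R) (f_ge0 : forall x, 0 <= f x)
  (fpi_prob : is_prob (fun x => f x * pi x)) :
  (weak_W2_sq K (fun x => (f x * pi x)%R) pi
     <= (2 * sup_jump_rate K / kappa ^+ 2)%:E * fisher_info K pi f)%E /\
  ((2 * sup_jump_rate K / kappa ^+ 2)%:E * fisher_info K pi f
     <= (2 / kappa ^+ 2)%:E * fisher_info K pi f)%E.
Proof.
split.
  apply/lee_addgt0Pr => d d0.
  set J := sup_jump_rate K; pose C := 4 * (2 * J / kappa) ^+ 2 * 4.
  have C0 : 0 <= C by rewrite mulr_ge0 // mulr_ge0 ?sqr_ge0.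
  (* The total redrawing error is [C * e], which this choice keeps below [d]. *)
  pose e := Num.min 2^-1 (d / (C + 1)).
  have e0 : 0 < e by rewrite lt_min invr_gt0 ltr0n divr_gt0 // ltr_wpDl.
  have e2 : e <= 2^-1 by rewrite ge_min lexx.
  apply: le_trans (weak_W2_sq_approx K_markov K_irreducible pi_prob pi_reversible
    kappa_gt0 K_CDE' e0 e2 f_ge0 fpi_prob) _.
  apply: leeD => //; rewrite lee_fin mulrA -/J -/C.
  have : e <= d / (C + 1) by rewrite ge_min lexx orbT.
  rewrite ler_pdivlMr ?ltr_wpDl // => h; apply: le_trans h.
  by rewrite mulrC ler_wpM2l ?(ltW e0) // lerDl.
apply: lee_wpmul2r; first exact: fisher_ge0.
rewrite lee_fin ler_wpM2r ?invr_ge0 ?sqr_ge0 //.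
have [x0 _] := prob_gt0 pi_prob.
by have := sup_jump_rate_le1 K_markov x0; lra.
Qed.
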